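(* Let $\lambda/\mu$ be a skew shape with $n$ columns, let $\gamma/\nu$ be a skew shape, and suppose $g_{\lambda/\mu}=g_{\gamma/\nu}$ (so that $\gamma/\nu$ must also have $n$ columns). Then \[ b_i^{\lambda/\mu}+b_{n-i+1}^{\lambda/\mu}=b_i^{\gamma/\nu}+b_{n-i+1}^{\gamma/\nu} \] for $i=1,2,\ldots,n$.
   Context: A skew shape $\lambda/\mu$ is a pair of partitions $\lambda=\langle\lambda_1,\ldots,\lambda_m\rangle$ and $\mu=\langle\mu_1,\ldots,\mu_k\rangle$ with $k\le m$ and $\mu_i\le\lambda_i$ for all $i$; its Young diagram (English notation) consists of the boxes in the Young diagram of $\lambda$ that are not in that of $\mu$. The rows and columns of a shape are its nonempty rows and columns, with rows numbered $1,\dots,m$ from top to bottom and columns numbered $1,\dots,n$ from left to right. A reverse plane partition of shape $\lambda/\mu$ is a filling of the boxes with positive integers that weakly increase from left to right across rows and weakly increase from top to bottom down columns. Its monomial is $x^P=\prod_{i\ge1}x_i^{m_i}$, where $m_i$ is the number of columns of $P$ containing the integer $i$. The dual stable Grothendieck polynomial is $g_{\lambda/\mu}=\sum_P x^P$, summed over all reverse plane partitions of shape $\lambda/\mu$. An interior horizontal edge is a horizontal edge of a box in the diagram lying neither at the top boundary nor at the bottom boundary of the diagram. A bottleneck edge is an interior horizontal edge touching both the left and right boundaries of the shape. The bottleneck number $b_i^{\lambda/\mu}$ is the number of bottleneck edges in column $i$. Equivalently, if the shape has $m$ rows and $n$ columns (occupying rows $1,\dots,m$ and columns $1,\dots,n$),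 then for $1\le i\le n$, \[ b_i^{\lambda/\mu}=|\{1\le j\le m-1 \mid \mu_j=i-1,\ \lambda_{j+1}=i\}|, \] where $\mu_j=0$ when $j$ exceeds the number of parts of $\mu$.
   Formalization: The formal theorem additionally assumes that λ/μ is connected (through common edges); for disconnected shapes the claim fails, e.g. for ⟨3,2,1,1⟩/⟨2,1⟩ and ⟨3,2,2,1⟩/⟨2,1,1⟩, which have equal g. *)

(* Defs.v *)
From mathcomp Require Import all_boot finmap zify.
Set Implicit Arguments.
Unset Strict Implicit.
Unset Printing Implicit Defensive.

Definition is_partition (l : seq nat) : bool := sorted geq l && (0 \notin l).

(* Rows, columns and parts are numbered from 1; [part l i] is 0 for i = 0 and
   for i larger than the number of parts. *)
Definition part (l : seq nat) (i : nat) : nat := nth 0 (0 :: l) i.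

Definition is_skew (lam mu : seq nat) : bool :=
  [&& is_partition lam, is_partition mu, size mu <= size lam
    & all (fun i => part mu i <= part lam i) (iota 1 (size mu))].

Definition in_diagram (lam mu : seq nat) (r c : nat) : bool :=
  part mu r < c <= part lam r.

Definition box (lam mu : seq nat) : finType :=
  {p : 'I_(size lam).+1 * 'I_(part lam 1).+1 | in_diagram lam mu p.1 p.2}.

Definition brow lam mu (b : box lam mu) : 'I_(size lam).+1 := (val b).1.
Definition bcol lam mu (b : box lam mu) : 'I_(part lam 1).+1 := (val b).2.

Definition adjacent lam mu : rel (box lam mu) := fun b b' =>
  ((brow b == brow b') && ((bcol b == (bcol b').+1 :> nat)
                           || (bcol b' == (bcol b).+1 :> nat)))
  || ((bcol b == bcol b') && ((brow b == (brow b').+1 :> nat)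
                              || (brow b' == (brow b).+1 :> nat))).

(* Connectedness is through common edges, not corners.  The components of a
   disconnected shape can be reordered without changing g but not without moving
   the bottleneck edges: <3,2,1,1>/<2,1> and <3,2,2,1>/<2,1,1> both consist of
   two single boxes and a column of two boxes, which is the first column of the
   former and the second column of the latter. *)
Definition is_connected (lam mu : seq nat) : bool :=
  [forall b : box lam mu, forall b' : box lam mu,
     connect (@adjacent lam mu) b b'].

Definition columns (lam mu : seq nat) : seq nat :=
  [seq c <- iota 1 (part lam 1) |
     has (fun r => in_diagram lam mu r c) (iota 1 (size lam))].

Definition ncols (lam mu : seq nat) : nat := size (columns lam mu).

(* The position, in the diagram, of the i-th nonempty column from the left;
   it is i itself when the shape occupies columns 1, ..., n. *)
Definition column (lam mu : seq nat) (i : nat) : nat :=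
  nth 0 (columns lam mu) i.-1.

Definition is_rpp lam mu (P : box lam mu -> nat) : bool :=
  [&& [forall b, 0 < P b],
      [forall b, forall b',
         (brow b == brow b') && (bcol b <= bcol b') ==> (P b <= P b')]
    & [forall b, forall b',
         (bcol b == bcol b') && (brow b <= brow b') ==> (P b <= P b')]].

(* Monomials in x_1, x_2, ... are finitely supported exponent functions. *)
Definition monomial : Type := {fsfun nat -> nat with 0}.

Definition col_mult lam mu (P : box lam mu -> nat) (i : nat) : nat :=
  #|[set bcol b | b in [set b | P b == i]]|.

Definition rpp_monomial lam mu (P : box lam mu -> nat) : monomial :=
  [fsfun i in seq_fset tt (codom P) => col_mult P i].

Lemma rpp_monomialE lam mu (P : box lam mu -> nat) i :
  rpp_monomial P i = col_mult P i.
Proof.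
rewrite fsfunE seq_fsetE; case: ifP => // /negP iP.
apply/esym/eqP; rewrite cards_eq0; apply/eqP/setP=> c; rewrite [RHS]inE.
apply/imsetP=> -[b]; rewrite inE => /eqP Pb _; apply: iP.
by rewrite -Pb codom_f.
Qed.

Lemma finsupp_rpp_monomial lam mu (P : box lam mu -> nat) b :
  P b \in finsupp (rpp_monomial P).
Proof.
rewrite mem_finsupp rpp_monomialE -lt0n card_gt0; apply/set0Pn.
by exists (bcol b); apply: imset_f; rewrite inE.
Qed.

(* The formal power series g_{lam/mu} in infinitely many variables, given by
   its coefficients: the coefficient of x^a is the number of reverse plane
   partitions P with x^P = x^a.  By [finsupp_rpp_monomial], all entries of such
   a P lie in the support of a, so they range over a finite type. *)
Definition dual_grothendieck (lam mu : seq nat) (a : monomial) : nat :=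
  #|[set P : {ffun box lam mu -> finsupp a} |
      is_rpp (fun b => val (P b)) &&
      (rpp_monomial (fun b => val (P b)) == a)]|.

(* Horizontal edges are designated by the box (r, c) of which they are the
   bottom edge, so that (r, c) and (r + 1, c) are the two boxes they separate.
   An interior edge touches the left (right) boundary at its left (right)
   endpoint, when one of these two boxes has no left (right) neighbour. *)
Definition interior_edge (lam mu : seq nat) (r c : nat) : bool :=
  in_diagram lam mu r c && in_diagram lam mu r.+1 c.

Definition touches_left (lam mu : seq nat) (r c : nat) : bool :=
  ~~ in_diagram lam mu r c.-1 || ~~ in_diagram lam mu r.+1 c.-1.

Definition touches_right (lam mu : seq nat) (r c : nat) : bool :=
  ~~ in_diagram lam mu r c.+1 || ~~ in_diagram lam mu r.+1 c.+1.

Definition bottleneck_edge (lam mu : seq nat) (r c : nat) : bool :=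
  [&& interior_edge lam mu r c, touches_left lam mu r c
    & touches_right lam mu r c].

Definition bottleneck (lam mu : seq nat) (i : nat) : nat :=
  count (fun r => bottleneck_edge lam mu r (column lam mu i))
        (iota 1 (size lam).-1).

Lemma part_le l r : is_partition l -> 0 < r -> part l r.+1 <= part l r.
Proof.
case: r => // r /andP[sl _] _; rewrite /part /=.
have [lt_r | le_r] := ltnP r.+1 (size l); last by rewrite nth_default.
have geq_trans : transitive geq by move=> y x z /= xy yz; apply: leq_trans xy.
by apply: (sorted_ltn_nth geq_trans 0 sl) => //; rewrite inE // ltnW.
Qed.

Lemma bottleneck_edgeE lam mu r c : is_skew lam mu -> 0 < r -> 0 < c ->
  bottleneck_edge lam mu r c = (part mu r == c.-1) && (part lam r.+1 == c).
Proof.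
case/and4P=> plam pmu _ _ r0 c0.
have := part_le plam r0; have := part_le pmu r0.
rewrite /bottleneck_edge /interior_edge /touches_left /touches_right.
rewrite /in_diagram; case: c c0 => // c _ /=.
move: (part mu r) (part mu r.+1) (part lam r) (part lam r.+1) => a b d e ba ed.
lia.
Qed.

(* Main.v *)
Require Import Defs.
From mathcomp Require Import all_boot finmap.
From mathcomp Require Import zify.
Set Implicit Arguments.
Unset Strict Implicit.
Unset Printing Implicit Defensive.

(** Peeling off the values 1, 2, ... in turn, a reverse plane partition is a
    chain of order ideals of the diagram, and its monomial records the number of
    columns that meet each layer of the chain ([dual_grothendieck_chains]).  All
    the information about g used below is the number of such chains for suitable
    column counts.

    One value gives the number n of columns.  Two values with x_1 x_2^(n-1)
    count the ideals consisting of one full column, one for each component of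
    the shape; so the second shape is connected as well.

    Two values with x_1^k x_2^(n+1-k) count the ideals for which exactly one
    column contains both values.  Group these by the row r below which the mixed
    column changes from 1 to 2.  Rows r and r + 1 share the columns from
    p = mu_r + 1 to q = lambda_(r+1).  If p < q, exactly one ideal has k columns
    meeting its value 1; if p = q, then (r, p) is a bottleneck edge, the columns
    on both sides of p can be chosen freely, and the count is
    tent n k p = min(k, n+1-k, p, n+1-p) ([card_two_layer_ideals]).  The coefficient
    is thus F + D(k), where D is the sum of the tent functions at all bottlenecks
    and F is the number of r such that rows r and r + 1 share at least two
    columns.  As a function of k, tent n k p is piecewise linear with kinks at p
    and n+1-p only, so 2 D(j) - D(j-1) - D(j+1) = b_j + b_(n+1-j) for 1 <= j <= n
    ([bottleneck_second_difference]).  For j = 1 and j = n this involves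
    D(0) = D(n+1) = 0, which are not among the coefficients, so F must be known.

    Determining F uses the top degree part of g, the skew Schur function s.  Its
    coefficients count chains whose layers are horizontal strips.  Write H_l and
    E_l for peeling off a horizontal or a vertical strip of size l.  Then
    sum_j (-1)^j E_j H_(N-j) = 0 for N > 0 ([alternating_VH]), which expresses
    every mixed word in the E's and H's by words in the H's; hence s determines
    the number of chains for mixed words too ([strip_words_determined]).  Peel
    off a horizontal strip of size n: this removes the top box of every column,
    and what remains in row r + 1 is its overlap with row r.  Peel off a vertical
    strip with one box in each of these overlaps (their number is the
    coefficient for k = 1).  The largest vertical strip that can be peeled off
    next has F boxes ([overlaps_bound], [overlaps_attained]). *)

(** * Chains of order ideals *)

(** A layer is prescribed by the number of columns that it meets, as for the
    boxes of one value of a reverse plane partition, or as a horizontal or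
    vertical strip of given size. *)
Inductive layer := ColLayer of nat | HStrip of nat | VStrip of nat.

Section Chains.
Variables lam mu : seq nat.
Local Notation T := (box lam mu).
Implicit Types (b : T) (U V W S : {set T}) (x : layer) (w : seq layer).

(** Only boxes of a common row or column are compared, because these are the
    comparisons in the definition of a reverse plane partition. *)
Definition below b b' : bool :=
  ((brow b == brow b') && (bcol b <= bcol b')) ||
  ((bcol b == bcol b') && (brow b <= brow b')).

Definition ideal U : bool :=
  [forall b, forall b', below b b' && (b' \in U) ==> (b \in U)].

Definition ncol S : nat := #|[set bcol b | b in S]|.
Definition nrow S : nat := #|[set brow b | b in S]|.

Definition is_layer x S : bool :=
  match x with
  | ColLayer l => ncol S == l
  | HStrip l => (ncol S == l) && (#|S| == l)
  | VStrip l => (nrow S == l) && (#|S| == l)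
  end.

Definition step x U W : bool := [&& ideal W, U \subset W & is_layer x (W :\: U)].

Fixpoint chains w U : nat :=
  if w is x :: w' then \sum_(W | step x U W) chains w' W else (U == setT).

Lemma idealP U :
  reflect (forall b b', below b b' -> b' \in U -> b \in U) (ideal U).
Proof.
apply: (iffP forallP) => [idU b b' bb' b'U | idU b].
  by have /forallP/(_ b') := idU b; rewrite bb' b'U.
by apply/forallP => b'; apply/implyP=> /andP[]; apply: idU.
Qed.

Lemma box_inj b b' : brow b = brow b' -> bcol b = bcol b' -> b = b'.
Proof.
rewrite /brow /bcol => e1 e2; apply: val_inj.
by rewrite (surjective_pairing (val b)) e1 e2 -surjective_pairing.
Qed.

Lemma below_left b b' : brow b = brow b' -> bcol b <= bcol b' -> below b b'.
Proof. by rewrite /below => -> ->; rewrite eqxx. Qed.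

Lemma below_up b b' : bcol b = bcol b' -> brow b <= brow b' -> below b b'.
Proof. by rewrite /below => -> ->; rewrite eqxx orbT. Qed.

Lemma ideal0 : ideal set0.
Proof. by apply/idealP=> b b'; rewrite !inE. Qed.

Lemma idealT : ideal setT.
Proof. by apply/idealP=> b b'; rewrite !inE. Qed.

Lemma ncol_le S : ncol S <= #|S|.
Proof. exact: leq_imset_card. Qed.

Lemma ncol_cardP S :
  reflect {in S &, injective (@bcol lam mu)} (ncol S == #|S|).
Proof. exact: imset_injP. Qed.

Lemma nrow_cardP S :
  reflect {in S &, injective (@brow lam mu)} (nrow S == #|S|).
Proof. exact: imset_injP. Qed.

Lemma is_HStripE l S : is_layer (HStrip l) S = (ncol S == #|S|) && (#|S| == l).
Proof. by rewrite /=; case: (#|S| =P l) => [->|]; rewrite ?andbT ?andbF. Qed.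

Lemma is_VStripE l S : is_layer (VStrip l) S = (nrow S == #|S|) && (#|S| == l).
Proof. by rewrite /=; case: (#|S| =P l) => [->|]; rewrite ?andbT ?andbF. Qed.

(** * Vertical strips against horizontal strips *)

(** For fixed U and W, the terms E_j H_(N-j) with outcome W are the V that
    satisfy this predicate. *)
Definition splitting U W V : bool :=
  [&& ideal V, U \subset V, V \subset W,
      nrow (V :\: U) == #|V :\: U| & ncol (W :\: V) == #|W :\: V|].

Definition toggle b V := if b \in V then V :\ b else b |: V.

Lemma toggleK b : involutive (toggle b).
Proof.
rewrite /toggle => V; have [bV|bV] := boolP (b \in V).
  by rewrite setD11 setD1K.
by rewrite setU11 setU1K.
Qed.

(** The leftmost box of the lowest row. *)
Definition swcorner W b := (b \in W) /\
  forall b', b' \in W -> brow b' <= brow b /\ (brow b' = brow b -> bcol b <= bcol b').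

Lemma swcorner_exists W : W != set0 -> exists b, swcorner W b.
Proof.
case/set0Pn=> b0 b0W.
have [b1 b1W max1] := @arg_maxnP _ b0 (mem W) (fun b => brow b : nat) b0W.
have {}b1W : b1 \in W by [].
pose Q := [pred b | (b \in W) && (brow b == brow b1)].
have Qb1 : Q b1 by rewrite inE /= b1W /=.
have [b2 /andP[b2W /eqP r2] min2] := @arg_minnP _ b1 Q (fun b => bcol b : nat) Qb1.
exists b2; split=> // b' b'W; rewrite r2; split; first exact: max1.
by move=> r'; apply: min2; rewrite inE /= b'W r' /=.
Qed.

(** The box b has neither a left nor a lower neighbour in W minus U, and only
    these could force it into the horizontal or the vertical strip. *)
Lemma toggle_splitting U W b V : ideal U -> ideal W -> swcorner (W :\: U) b ->
  splitting U W V -> splitting U W (toggle b V).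
Proof.
move=> /idealP idU /idealP idW [bWU sw] /and5P[/idealP idV UV VW].
move/nrow_cardP=> rV /ncol_cardP cV.
have [bW bU] : b \in W /\ b \notin U by move: bWU; rewrite inE => /andP[].
have inWU b' : b' \in W -> b' \notin U -> b' \in W :\: U by rewrite inE => -> ->.
rewrite /toggle; case: ifPn => bV; apply/and5P; split.
- apply/idealP=> b1 b2 b12; rewrite !inE => /andP[b2b b2V].
  rewrite (idV _ _ b12 b2V) andbT; apply: contraNneq (bU) => eb; rewrite {b1}eb in b12 *.
  have [b2U | b2U] := boolP (b2 \in U); first exact: idU b2U.
  case/orP: (b12) => /andP[/eqP e le].
    by case/eqP: b2b; apply: rV; rewrite ?inE ?bU ?b2U ?bV ?b2V.
  have [le' _] := sw _ (inWU _ (subsetP VW _ b2V) b2U).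
  case/eqP: b2b; apply: box_inj => //; apply/val_inj/eqP.
  by rewrite eqn_leq le le'.
- apply/subsetP=> b' b'U; rewrite !inE (subsetP UV _ b'U) andbT.
  by apply: contraNneq bU => <-.
- by apply: subset_trans VW; apply: subsetDl.
- apply/nrow_cardP=> b1 b2; rewrite !inE => /and3P[u1 _ v1] /and3P[u2 _ v2].
  by apply: rV; rewrite inE ?u1 ?u2.
- have key b' : b' \in W -> b' \notin V -> bcol b' <> bcol b.
    move=> b'W b'V ec; case/negP: (b'V); apply: idV bV; apply: below_up => //.
    have b'U : b' \notin U by apply: contraNN b'V => /(subsetP UV).
    by have [] := sw _ (inWU _ b'W b'U).
  apply/ncol_cardP=> b1 b2; rewrite !inE !(negb_and (_ != _)) !negbK.
  case/andP=> [/orP[/eqP->|v1] w1] /andP[/orP[/eqP->|v2] w2] //.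
  + by move/esym/(key _ w2 v2).
  + by move/(key _ w1 v1).
  + by apply: cV; rewrite inE ?v1 ?v2.
- apply/idealP=> b1 b2 b12; rewrite !inE => /orP[/eqP eb|b2V]; last first.
    by rewrite (idV _ _ b12 b2V) orbT.
  rewrite {b2}eb in b12; have [b1V|b1V] := boolP (b1 \in V); first by rewrite orbT.
  rewrite orbF; have b1W := idW _ _ b12 bW.
  case/orP: (b12) => /andP[/eqP e le].
    have b1U : b1 \notin U by apply: contraNN b1V => /(subsetP UV).
    have [_ /(_ e) le'] := sw _ (inWU _ b1W b1U).
    by apply/eqP/box_inj => //; apply/val_inj/eqP; rewrite eqn_leq le le'.
  by apply/eqP/cV; rewrite ?inE ?bV ?b1V.
- by apply: subset_trans UV _; apply: subsetUr.
- by rewrite subUset sub1set bW.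
- have key b' : b' \in V -> b' \notin U -> brow b' <> brow b.
    move=> b'V b'U er; case/negP: (bV); apply: idV (b'V); apply: below_left => //.
    by have [_ /(_ er)] := sw _ (inWU _ (subsetP VW _ b'V) b'U).
  apply/nrow_cardP=> b1 b2; rewrite !inE.
  case/andP=> [u1 /orP[/eqP->|v1]] /andP[u2 /orP[/eqP->|v2]] //.
  + by move/esym/(key _ v2 u2).
  + by move/(key _ v1 u1).
  + by apply: rV; rewrite inE ?u1 ?u2.
- apply/ncol_cardP=> b1 b2; rewrite !inE !(negb_or (_ == _)) => /andP[/andP[_ v1] w1] /andP[/andP[_ v2] w2].
  by apply: cV; rewrite inE ?v1 ?v2.
Qed.

Lemma odd_toggle U W b V : swcorner (W :\: U) b -> U \subset V ->
  odd #|toggle b V :\: U| = ~~ odd #|V :\: U|.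
Proof.
case; rewrite inE => /andP[bU _] _ UV; rewrite /toggle; case: ifPn => bV.
  rewrite [in RHS](cardsD1 b) !inE bU bV /= negbK; congr (odd #|pred_of_set _|).
  by apply/setP=> c; rewrite !inE andbCA.
rewrite (cardsD1 b) !inE bU eqxx /=; congr (~~ (odd #|pred_of_set _|)).
apply/setP=> c; rewrite !inE; case: (c =P b) => [->|] //=.
by rewrite (negbTE bV) andbF.
Qed.

(** Toggling the south-west corner of W minus U is a sign-reversing involution. *)
Lemma splitting_balanced U W : ideal U -> ideal W -> U \proper W ->
  #|[set V | splitting U W V && odd #|V :\: U|]| =
  #|[set V | splitting U W V && ~~ odd #|V :\: U|]|.
Proof.
move=> idU idW; rewrite properEneq eqEsubset => /andP[nWU UW]; rewrite UW /= in nWU.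
have [|b sw] := @swcorner_exists (W :\: U); first by rewrite setD_eq0.
rewrite -(card_imset _ (can_inj (toggleK b))); congr #|pred_of_set _|.
apply/setP=> V; apply/imsetP/idP => [[V' + ->]|].
  rewrite !inE => /andP[sV oV]; rewrite toggle_splitting //.
  by rewrite (odd_toggle sw) ?oV //; case/and5P: sV.
rewrite inE => /andP[sV oV]; exists (toggle b V); last by rewrite toggleK.
rewrite inE toggle_splitting // (odd_toggle sw) //; by case/and5P: sV.
Qed.


Lemma card_stepD U V W : U \subset V -> V \subset W ->
  #|W :\: U| = #|V :\: U| + #|W :\: V|.
Proof.
move=> UV VW; have UW := subset_trans UV VW.
have := subset_leq_card UV; have := subset_leq_card VW.
rewrite !cardsD (setIidPr UV) (setIidPr UW) (setIidPr VW); lia.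
Qed.

(** The weight f selects signs: with f the parity, both sides of the
    alternating identity have this form. *)
Lemma sum_VH (f : nat -> bool) N w U : ideal U ->
  \sum_(j < N.+1) f j * chains (VStrip j :: HStrip (N - j) :: w) U =
  \sum_(W | [&& ideal W, U \subset W & #|W :\: U| == N])
     #|[set V | splitting U W V && f #|V :\: U|]| * chains w W.
Proof.
move=> idU; rewrite [RHS]big_mkcond /=.
pose c V W j := (f j && step (VStrip j) U V) && step (HStrip (N - j)) V W.
transitivity (\sum_(j < N.+1) \sum_W \sum_V c V W j * chains w W).
  apply: eq_bigr => j _; rewrite big_distrr /= big_mkcond [RHS]exchange_big.
  apply: eq_bigr => V _ /=; case: ifPn => sV.
    rewrite big_distrr /= big_mkcond; apply: eq_bigr => W _.
    rewrite /c sV andbT; case: ifPn => sW; last by rewrite andbF.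
    by rewrite andbT.
  by apply/esym/big1 => W _; rewrite /c (negbTE sV) andbF.
rewrite exchange_big; apply: eq_bigr => W _ /=; rewrite exchange_big /=.
transitivity (\sum_V ([&& ideal W, U \subset W & #|W :\: U| == N] &&
    (splitting U W V && f #|V :\: U|)) * chains w W); last first.
  case: ifP => cW; last by apply: big1.
  rewrite -[in RHS]sum1_card big_distrl [RHS]big_mkcond /=.
  apply: eq_bigr => V _; rewrite inE.
  by case: ifP => _; rewrite ?mul1n.
apply: eq_bigr => V _; set d := (X in _ = (nat_of_bool X) * _).
have cE (j : 'I_N.+1) : c V W j = d && (j == #|V :\: U| :> nat).
  rewrite /c /d /step is_HStripE is_VStripE /splitting.
  have jN : j <= N by rewrite -ltnS.
  have [UV|_] := boolP (U \subset V); last by rewrite !(andbF, andFb).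
  have [VW|_] := boolP (V \subset W); last by rewrite !(andbF, andFb).
  rewrite (subset_trans UV VW) (card_stepD UV VW).
  rewrite [_ == nat_of_ord j]eq_sym.
  have [ej|nej] := eqVneq (j : nat) #|V :\: U|; last by rewrite !(andbF, andFb).
  have -> : (#|W :\: V| == N - j) = (#|V :\: U| + #|W :\: V| == N) by lia.
  rewrite -ej /=.
  by move: (f j) (ideal V) (ideal W) (nrow _ == _) (ncol _ == _) (_ + _ == _)
    => [] [] [] [] [] [].
under eq_bigr => j _ do rewrite cE.
have [dT|dF] := boolP d; last by rewrite big1.
have ltN : #|V :\: U| < N.+1.
  move: dT; rewrite /d => /andP[/and3P[_ _ /eqP <-]] /andP[/and5P[_ UV VW _ _] _].
  by rewrite ltnS (card_stepD UV VW) leq_addr.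
rewrite (bigD1 (Ordinal ltN)) //= eqxx big1 ?addn0 // => j.
by rewrite -(inj_eq val_inj) /= => /negbTE->.
Qed.

(** This is the relation sum_j (-1)^j E_j H_(N-j) = 0, with the odd terms on
    one side so that it makes sense in nat. *)
Lemma alternating_VH N w U : ideal U -> 0 < N ->
  \sum_(j < N.+1) odd j * chains (VStrip j :: HStrip (N - j) :: w) U =
  \sum_(j < N.+1) ~~ odd j * chains (VStrip j :: HStrip (N - j) :: w) U.
Proof.
move=> idU N0; rewrite (sum_VH odd) // (sum_VH (fun j => ~~ odd j)) //.
apply: eq_bigr => W /and3P[idW UW /eqP cW]; congr (_ * _).
apply: splitting_balanced => //; rewrite properE UW -setD_eq0.
by rewrite -cards_eq0 cW -lt0n.
Qed.

End Chains.

(** * Strip words are determined by the coefficients *)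

Section Words.
Variables lam mu : seq nat.
Local Notation T := (box lam mu).
Implicit Types (b : T) (U V W S : {set T}) (x : layer) (w : seq layer).

Lemma chains_cat w1 w2 w3 : (forall U, chains w2 U = chains w3 U) ->
  forall U, chains (w1 ++ w2) U = chains (w1 ++ w3) U.
Proof.
move=> e; elim: w1 => //= x w1 IH U.
by apply: eq_bigr => W _; apply: IH.
Qed.

Lemma VStrip0 w U : chains (VStrip 0 :: w) U = chains (HStrip 0 :: w) U.
Proof.
rewrite /=; apply: eq_bigl => W; rewrite /step is_HStripE is_VStripE; congr [&& _, _ & _].
case: (#|W :\: U| =P 0) => [/eqP|_]; last by rewrite !andbF.
by rewrite cards_eq0 => /eqP->; rewrite /nrow /ncol !imset0 !cards0.
Qed.

Lemma alternating_cat N w1 w2 U : ideal U -> 0 < N ->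
  \sum_(j < N.+1) odd j * chains (w1 ++ VStrip j :: HStrip (N - j) :: w2) U =
  \sum_(j < N.+1) ~~ odd j * chains (w1 ++ VStrip j :: HStrip (N - j) :: w2) U.
Proof.
move=> + N0; elim: w1 U => [|x w1 IH] U idU; first exact: alternating_VH.
rewrite /=; under eq_bigr do rewrite big_distrr /=.
under [RHS]eq_bigr do rewrite big_distrr /=.
rewrite exchange_big [RHS]exchange_big; apply: eq_bigr => W /and3P[idW _ _].
exact: IH.
Qed.

Lemma chains_HStrip_neq0 ls U : chains (map HStrip ls) U != 0 -> sumn ls = #|~: U|.
Proof.
elim: ls U => [|l ls IH] U /=.
  by rewrite eqb0 negbK => /eqP->; rewrite setCT cards0.
rewrite sum_nat_eq0 negb_forall => /existsP[W].
rewrite negb_imply => /andP[/and3P[_ UW /andP[_ /eqP <-]] /IH ->].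
by rewrite -!setTD [RHS](card_stepD UW) ?subsetT.
Qed.

Lemma chains_ColLayer_neq0 ls U :
  chains (map ColLayer ls) U != 0 -> sumn ls <= #|~: U|.
Proof.
elim: ls U => [|l ls IH] U //=.
rewrite sum_nat_eq0 negb_forall => /existsP[W].
rewrite negb_imply => /andP[/and3P[_ UW /eqP <-] /IH le].
by rewrite -!setTD (card_stepD UW) ?subsetT // setTD leq_add ?ncol_le.
Qed.

(** A layer meets at most as many columns as it has boxes, so if the column
    counts add up to the number of boxes, every layer is a horizontal strip. *)
Lemma chains_top_degree ls U : sumn ls = #|~: U| ->
  chains (map ColLayer ls) U = chains (map HStrip ls) U.
Proof.
elim: ls U => [|l ls IH] U //= eU.
rewrite big_mkcond [RHS]big_mkcond; apply: eq_bigr => W _ /=; rewrite /step /=.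
have [idW|] //= := boolP (ideal W); have [UW|] //= := boolP (U \subset W).
have [el|] //= := ncol _ =P l.
have := card_stepD UW (subsetT W); rewrite !setTD -eU => e.
have := ncol_le (W :\: U); rewrite el leq_eqVlt => /predU1P[e'|lt].
  by rewrite -e' eqxx IH //; lia.
case: ifP => [/eqP e2|_]; first by rewrite e2 ltnn in lt.
by apply/eqP; apply: contraTT lt => /chains_ColLayer_neq0; lia.
Qed.

Lemma ideal_extend U : ideal U -> U != setT ->
  exists2 b, b \notin U & ideal (b |: U).
Proof.
move=> /idealP idU; rewrite -subTset -setD_eq0 setTD => /set0Pn[b0 b0U].
have [b bU minb] := @arg_minnP _ b0 (mem (~: U)) (fun b => brow b + bcol b : nat) b0U.
have {}bU : b \notin U by move: bU; rewrite /= inE.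
exists b => //; apply/idealP=> b1 b2 b12; rewrite !inE => /predU1P[e2|b2U]; last first.
  by rewrite (idU _ _ b12) ?orbT.
rewrite {b2}e2 in b12; have [|b1U] := boolP (b1 \in U); first by rewrite orbT.
rewrite orbF; have le : brow b + bcol b <= brow b1 + bcol b1.
  by apply: minb; rewrite /= inE.
by case/orP: b12 => /andP[/eqP e le']; apply/eqP/box_inj => //; apply: val_inj;
  rewrite /= in le *; move: le le'; rewrite e; lia.
Qed.

(** A linear extension of the poset of boxes exists. *)
Lemma chains_singletons U : ideal U -> 0 < chains (nseq #|~: U| (HStrip 1)) U.
Proof.
move En: #|~: U| => n; elim: n U En => [|n IH] U En idU.
  by move/eqP: En; rewrite cards_eq0 -setTD setD_eq0 subTset /= => ->.
have [|b bU idb] := ideal_extend idU.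
  by apply: contra_eqN En => /eqP->; rewrite setCT cards0.
rewrite /= lt0n sum_nat_eq0 negb_forall; apply/existsP; exists (b |: U).
have eD : (b |: U) :\: U = [set b].
  by apply/setP=> c; rewrite !inE; case: eqP => [->|]; rewrite ?bU //= andNb.
rewrite negb_imply /step idb subsetUr /= eD /ncol imset_set1 !cards1 /= -lt0n IH //.
have := card_stepD (subsetUr [set b] U) (subsetT _).
by rewrite !setTD En eD cards1 => -[].
Qed.

End Words.

(** The measure for rewriting words: replacing E_N by E_j H_(N-j) with j < N
    lowers it, and so does replacing E_0 by H_0. *)
Definition vweight (x : layer) : nat := if x is VStrip l then l.+1 else 0.
Definition is_strip (x : layer) : bool := if x is ColLayer _ then false else true.

Lemma has_VStrip w : 0 < sumn (map vweight w) ->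
  exists w1 l w2, w = w1 ++ VStrip l :: w2.
Proof.
elim: w => //= -[l|l|l] w IH /=; last by exists [::], l, w.
  by case/IH=> w1 [k [w2 ->]]; exists (ColLayer l :: w1), k, w2.
by case/IH=> w1 [k [w2 ->]]; exists (HStrip l :: w1), k, w2.
Qed.

(** The alternating relation for N + 1, solved for its last term E_(N+1) H_0,
    replaces E_(N+1) by words of smaller weight in the same way for both
    shapes. *)
Lemma strip_words_determined lam mu gam nu :
  (forall ls, chains (map HStrip ls) (set0 : {set box lam mu}) =
              chains (map HStrip ls) (set0 : {set box gam nu})) ->
  forall w, all is_strip w ->
    chains w (set0 : {set box lam mu}) = chains w (set0 : {set box gam nu}).
Proof.
move=> eqH w; move En: (sumn (map vweight w)) => n.
elim/ltn_ind: n w En => n IH w En sw.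
have [n0|n0] := posnP n.
  suff -> : w = map HStrip (map (fun x => if x is HStrip l then l else 0) w).
    exact: eqH.
  rewrite {}n0 {IH} in En; elim: w En sw => //= -[l|l|l] w IHw //= En sw.
  by rewrite -IHw.
have [|w1 [N [w2 ew]]] := @has_VStrip w; first by rewrite En.
move: En sw; rewrite {w}ew map_cat sumn_cat all_cat /= => En sw.
case: N => [|N] in En sw *.
  rewrite !(chains_cat w1 (VStrip0 w2)).
  by apply: (IH (n.-1)); [lia | rewrite map_cat sumn_cat /=; lia | rewrite all_cat].
have := alternating_cat w1 w2 (ideal0 lam mu) (ltn0Sn N).
have := alternating_cat w1 w2 (ideal0 gam nu) (ltn0Sn N).
rewrite !(@big_ord_recr _ _ _ N.+1) /= !subnn.
have H0 l m : chains (w1 ++ VStrip N.+1 :: HStrip 0 :: w2) (set0 : {set box l m})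
   = chains (w1 ++ VStrip N.+1 :: w2) (set0 : {set box l m}).
  apply: chains_cat => U; rewrite /=; apply: eq_bigr => W /andP[idW _].
  rewrite (bigD1 W) /=; last first.
    by rewrite /step idW subxx setDv /= /ncol imset0 !cards0.
  rewrite big1 ?addn0 // => V /andP[/and3P[_ WV /andP[_]]].
  rewrite cards_eq0 setD_eq0 => VW; rewrite eqEsubset WV => /negP[].
  by rewrite VW.
rewrite !H0.
have eqj (f : nat -> bool) : \sum_(j < N.+1) f j *
     chains (w1 ++ VStrip j :: HStrip (N.+1 - j) :: w2) (set0 : {set box lam mu}) =
   \sum_(j < N.+1) f j *
     chains (w1 ++ VStrip j :: HStrip (N.+1 - j) :: w2) (set0 : {set box gam nu}).
  apply: eq_bigr => j _; congr (_ * _).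
  apply: (IH (sumn (map vweight w1) + j.+1 + sumn (map vweight w2))).
  - by have := ltn_ord j; lia.
  - by rewrite map_cat sumn_cat /=; lia.
  - by rewrite all_cat /=.
have := eqj odd; have := eqj (fun j => ~~ odd j) => /= -> ->.
by case: (odd N); rewrite /= ?mul1n ?mul0n ?addn0; lia.
Qed.

(** The number of boxes is the degree of g, which is attained by standard
    fillings. *)
Lemma card_box_le lam mu gam nu :
  (forall ls, chains (map ColLayer ls) (set0 : {set box lam mu}) =
              chains (map ColLayer ls) (set0 : {set box gam nu})) ->
  #|box lam mu| <= #|box gam nu|.
Proof.
move=> eqC; have := chains_singletons (ideal0 lam mu).
rewrite setC0 cardsT -map_nseq -chains_top_degree; last first.
  by rewrite setC0 cardsT sumn_nseq mul1n.
rewrite eqC lt0n => /chains_ColLayer_neq0.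
by rewrite setC0 cardsT sumn_nseq mul1n.
Qed.

Lemma chains_strips_eq lam mu gam nu :
  (forall ls, chains (map ColLayer ls) (set0 : {set box lam mu}) =
              chains (map ColLayer ls) (set0 : {set box gam nu})) ->
  forall w, all is_strip w ->
    chains w (set0 : {set box lam mu}) = chains w (set0 : {set box gam nu}).
Proof.
move=> eqC; apply: strip_words_determined => ls.
have eT : #|box lam mu| = #|box gam nu|.
  by apply/eqP; rewrite eqn_leq !card_box_le.
have [e|ne] := eqVneq (sumn ls) #|box lam mu|.
  by rewrite -!chains_top_degree ?eqC // setC0 cardsT -?eT.
have z l m : sumn ls != #|box l m| -> chains (map HStrip ls) (set0 : {set box l m}) = 0.
  move=> ne'; apply/eqP; apply: contraNT ne' => /chains_HStrip_neq0.
  by rewrite setC0 cardsT => ->.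
by rewrite !z // -eT.
Qed.

(** * Reverse plane partitions as chains *)

Section Fillings.
Variables lam mu : seq nat.
Local Notation T := (box lam mu).
Implicit Types (b : T) (U V W S : {set T}).

(** The state of a filling after the values up to s have been peeled off: the
    boxes in U, which had those values, are reset to 0, and the other values
    range over s + 1, ..., s + size ls.  Keeping the codomain 'I_N fixed avoids
    renumbering the values at each step. *)
Definition fillings N s (ls : seq nat) U : {set {ffun T -> 'I_N}} :=
  [set P : {ffun T -> 'I_N} |
    [&& [forall b, forall b', below b b' ==> (P b <= P b')],
        [forall b, if b \in U then P b == 0 :> nat else s < P b <= s + size ls]
      & [forall j : 'I_(size ls),
           ncol [set b | P b == s + j.+1 :> nat] == nth 0 ls j]]].

Lemma fillingsP N s ls U (P : {ffun T -> 'I_N}) :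
  reflect [/\ forall b b', below b b' -> P b <= P b',
              forall b, b \in U -> P b = 0 :> nat,
              forall b, b \notin U -> s < P b <= s + size ls
            & forall j, j < size ls ->
                ncol [set b | P b == s + j.+1 :> nat] = nth 0 ls j]
          (P \in fillings N s ls U).
Proof.
rewrite inE; apply: (iffP and3P) => [[mon val lay] | [mon zero pos lay]]; split.
- by move=> b b' bb'; have /forallP/(_ b') := forallP mon b; rewrite bb'.
- by move=> b bU; have := forallP val b; rewrite bU => /eqP.
- by move=> b bU; have := forallP val b; rewrite (negbTE bU).
- by move=> j lt_j; have /eqP := forallP lay (Ordinal lt_j).
- by apply/forallP=> b; apply/forallP=> b'; apply/implyP; apply: mon.
- by apply/forallP=> b; case: ifPn => bU; [apply/eqP; apply: zero | apply: pos].
- by apply/forallP=> j; apply/eqP/lay.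
Qed.

(** The next ideal W of the chain consists of the boxes with value at most
    s + 1; resetting its boxes to 0 gives the state after one more step. *)
Lemma card_fillings M s ls U : ideal U -> s + size ls <= M ->
  chains (map ColLayer ls) U = #|fillings M.+1 s ls U|.
Proof.
elim: ls s U => [|l ls IH] s U idU leM /=.
  have [-> | nU] := eqVneq U setT.
    rewrite (_ : fillings _ _ _ _ = [set [ffun=> ord0]]) ?cards1 //.
    apply/setP=> P; rewrite [RHS]inE; apply/fillingsP/eqP => [[_ z _ _]|->].
      by apply/ffunP=> b; rewrite ffunE; apply: val_inj; rewrite /= z ?inE.
    by split=> // [b b' _|b _|b]; rewrite ?ffunE // inE.
  rewrite (_ : fillings _ _ _ _ = set0) ?cards0 //; apply/setP=> P.
  rewrite [RHS]inE; apply/fillingsP=> -[_ _ pos _].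
  move: nU; rewrite -subTset => /subsetPn[b _ /pos]; rewrite /= addn0; lia.
have szE : size (l :: ls) = (size ls).+1 by [].
pose lev (P : {ffun T -> 'I_M.+1}) := [set b | P b <= s.+1].
have layerE (P : {ffun T -> 'I_M.+1}) : P \in fillings M.+1 s (l :: ls) U ->
    lev P :\: U = [set b | P b == s + 1 :> nat].
  case/fillingsP=> _ zero pos _; apply/setP=> b; rewrite !inE.
  have [/zero -> | /pos] := boolP (b \in U); rewrite /=; lia.
rewrite -sum1_card (partition_big lev (step (ColLayer l) U)) /=; last first.
  move=> P fP; rewrite /step /= (layerE _ fP); case/fillingsP: fP => mon zero pos lay.
  apply/and3P; split; last by rewrite (lay 0).
    by apply/idealP=> b b' /mon le; rewrite !inE; apply: leq_trans.
  by apply/subsetP=> b /zero e; rewrite inE e.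
apply: eq_bigr => W /and3P[idW UW lW].
rewrite (IH s.+1) //; last by rewrite /= in leM; lia.
pose G (P : {ffun T -> 'I_M.+1}) : {ffun T -> 'I_M.+1} :=
  [ffun b => if b \in W :\: U then inord s.+1 else P b].
have sM : s.+1 < M.+1 by rewrite /= in leM; lia.
have GE (P : {ffun T -> 'I_M.+1}) b :
    (G P b : nat) = if b \in W :\: U then s.+1 else P b.
  by rewrite ffunE; case: ifP => // _; rewrite inordK.
have injG : {in fillings M.+1 s.+1 ls W &, injective G}.
  move=> P1 P2 /fillingsP[_ z1 _ _] /fillingsP[_ z2 _ _] eG.
  apply/ffunP=> b; apply: val_inj.
  have [bW | bW] := boolP (b \in W); first by rewrite /= z1 ?z2.
  by have := congr1 (fun P : {ffun T -> 'I_M.+1} => P b : nat) eG; rewrite /= !GE inE (negbTE bW) andbF.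
rewrite -(card_in_imset injG) -sum1_card.
suff imG (P : {ffun T -> 'I_M.+1}) :
    P \in fillings M.+1 s (l :: ls) U /\ lev P == W <->
    P \in G @: fillings M.+1 s.+1 ls W.
  by apply: eq_bigl => P; apply/idP/idP => [/imG/andP | /andP/imG].
split=> [[fP /eqP levP] | /imsetP[P' + ->]]; last first.
  case/fillingsP=> mon zero pos lay.
  have levG : lev (G P') = W.
    apply/setP=> b; rewrite inE GE inE.
    have [bW|/pos bW] := boolP (b \in W); last by rewrite andbF; lia.
    by rewrite andbT; case: ifP; rewrite ?leqnn ?zero.
  split; last exact/eqP.
  apply/fillingsP; split.
  - move=> b b' bb'; rewrite !GE !inE.
    have [b'W | b'W] := boolP (b' \in W).
      have bW := idealP _ idW _ _ bb' b'W; rewrite bW !andbT.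
      have [b'U | b'U] := boolP (b' \in U).
        by rewrite (idealP _ idU _ _ bb' b'U) /= zero.
      by case: ifP => //; rewrite zero.
    rewrite andbF; have := pos _ b'W.
    by have := mon _ _ bb'; case: ifP => //; lia.
  - by move=> b bU; rewrite GE inE bU /= zero // (subsetP UW).
  - move=> b bU; rewrite GE inE bU andTb.
    by rewrite szE; have [bW | /pos] := boolP (b \in W); lia.
  - case=> [|j] lt_j.
      rewrite -(_ : W :\: U = [set b | G P' b == s + 1 :> nat]); first exact/eqP.
      apply/setP=> b; rewrite [RHS]inE GE.
      have [|] := boolP (b \in W :\: U); first by lia.
      rewrite inE negb_and negbK => bWU.
      have [bW | /pos] := boolP (b \in W); last by lia.
      by rewrite zero //; lia.
    rewrite /= -lay //; congr (ncol _); apply/setP=> b; rewrite !inE GE !inE.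
    case: ifP => [/andP[_ bW] | _]; last by lia.
    by rewrite zero //; lia.
case/fillingsP: (fP) => mon zero pos lay; have lE := layerE _ fP.
pose P0 : {ffun T -> 'I_M.+1} := [ffun b => if b \in W then ord0 else P b].
have P0E b : (P0 b : nat) = if b \in W then 0 else P b by rewrite ffunE; case: ifP.
apply/imsetP; exists P0.
  apply/fillingsP; split.
  - move=> b b' bb'; rewrite !P0E; case: ifP => // /negbT bW.
    case: ifP => [b'W | _]; last exact: mon.
    by rewrite (idealP _ idW _ _ bb' b'W) in bW.
  - by move=> b bW; rewrite P0E bW.
  - move=> b bW; rewrite P0E (negbTE bW).
    have /pos := contraNN (subsetP UW b) bW; rewrite szE.
    by move: bW; rewrite -levP inE; lia.
  - move=> j lt_j; rewrite -[RHS](lay j.+1 lt_j); congr (ncol _); apply/setP=> b.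
    by rewrite !inE P0E -levP inE; case: ifP => /=; lia.
apply/ffunP=> b; apply: val_inj; rewrite /= GE.
have [bWU | ] := ifPn.
  by move: bWU; rewrite -levP lE inE => /eqP->; rewrite addn1.
rewrite inE negb_and negbK P0E => /orP[bU|/negbTE-> //].
by rewrite (subsetP UW) // zero.
Qed.

End Fillings.

(** The list gives the exponents of x_1, x_2, ...; there is no variable x_0. *)
Definition monomial_of (ls : seq nat) : monomial :=
  [fsfun i in seq_fset tt (iota 1 (size ls)) => nth 0 ls i.-1].

Lemma monomial_ofE ls i : monomial_of ls i = if 0 < i then nth 0 ls i.-1 else 0.
Proof.
rewrite fsfunE seq_fsetE mem_iota; case: ifP => [/andP[-> _]|] //.
by case: i => //= i lt_i; rewrite nth_default //; lia.
Qed.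

(** Reverse plane partitions with a given monomial take values in its support,
    and the column counts in turn force every value to lie there. *)
Lemma dual_grothendieck_chains lam mu ls :
  dual_grothendieck lam mu (monomial_of ls) =
  chains (map ColLayer ls) (set0 : {set box lam mu}).
Proof.
rewrite (@card_fillings _ _ (size ls) 0) ?ideal0 // /dual_grothendieck.
set a := monomial_of ls.
have supp i : i \in finsupp a -> 0 < i <= size ls.
  rewrite mem_finsupp monomial_ofE; case: i => //= i.
  by apply: contraNT => /= lt_i; rewrite nth_default //; lia.
pose f (P : {ffun box lam mu -> finsupp a}) : {ffun box lam mu -> 'I_(size ls).+1} :=
  [ffun b => inord (val (P b))].
have fE P b : f P b = val (P b) :> nat.
  by rewrite ffunE inordK // ltnS; case/andP: (supp _ (valP (P b))).
have injf : injective f.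
  move=> P1 P2 e; apply/ffunP=> b; apply: val_inj.
  by rewrite -!fE e.
rewrite -(card_imset _ injf); congr #|pred_of_set _|.
apply/setP=> Q; apply/imsetP/fillingsP => [[P + ->] | [mon _ pos lay]].
  rewrite inE => /andP[/and3P[/forallP p0 /forallP prow /forallP pcol] /eqP ea]; split.
  - move=> b b'; rewrite !fE /below.
    have /forallP/(_ b')/implyP := prow b; have /forallP/(_ b')/implyP := pcol b.
    by move=> h1 h2 /orP[/h2|/h1].
  - by move=> b; rewrite inE.
  - by move=> b _; rewrite fE supp // (valP (P b)).
  - move=> j lt_j; have := congr1 (fun m : monomial => m j.+1) ea.
    rewrite rpp_monomialE monomial_ofE /= => <-; rewrite /ncol /col_mult.
    congr #|pred_of_set (_ @: pred_of_set _)|.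
    by apply/setP=> b; rewrite !inE fE.
have aE i : 0 < i <= size ls -> ncol [set b | Q b == i :> nat] = a i.
  by case: i => // i; rewrite monomial_ofE => /(lay i) /=.
have Qa b : (Q b : nat) \in finsupp a.
  have := pos b; rewrite inE => /(_ isT)/aE e.
  rewrite mem_finsupp -e -lt0n card_gt0; apply/set0Pn.
  by exists (bcol b); apply: imset_f; rewrite inE.
pose P := [ffun b => FSetSub (Qa b)].
have PE b : val (P b) = Q b by rewrite ffunE.
exists P; last by apply/ffunP=> b; apply: val_inj; rewrite /= fE PE.
rewrite inE; apply/andP; split.
  apply/and3P; split; apply/forallP=> b.
  - by rewrite PE; have := pos b; rewrite inE => /(_ isT)/andP[].
  - apply/forallP=> b'; apply/implyP=> h; rewrite !PE mon //.
    by rewrite /below h.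
  - apply/forallP=> b'; apply/implyP=> h; rewrite !PE mon //.
    by rewrite /below h orbT.
apply/eqP/fsfunP=> i; rewrite rpp_monomialE.
have eS : [set b | val (P b) == i] = [set b | Q b == i :> nat].
  by apply/setP=> b; rewrite !inE PE.
rewrite /col_mult eS; have [|nin] := boolP (0 < i <= size ls); first exact: aE.
rewrite fsfun_dflt; last by apply: contraNN nin => /supp.
apply/eqP; rewrite cards_eq0 -subset0; apply/subsetP=> c /imsetP[b].
rewrite inE => /eqP e _; case/negP: nin; rewrite -e.
by apply: pos; rewrite inE.
Qed.

(** * Columns and connectedness *)

Section Geometry.
Variables lam mu : seq nat.
Hypothesis skew : is_skew lam mu.
Local Notation T := (box lam mu).
Local Notation D := (in_diagram lam mu).
Implicit Types (b : T) (U V W S : {set T}).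

Lemma part_antimono l r r' : is_partition l -> 0 < r <= r' -> part l r' <= part l r.
Proof.
move=> pl /andP[r0]; elim: r' => [|r' IH]; first by lia.
rewrite leq_eqVlt => /predU1P[-> //|lt_r].
by apply: leq_trans (IH lt_r); apply: part_le => //; lia.
Qed.

Lemma lam_antimono r r' : 0 < r <= r' -> part lam r' <= part lam r.
Proof. by apply: part_antimono; case/and4P: skew. Qed.

Lemma mu_antimono r r' : 0 < r <= r' -> part mu r' <= part mu r.
Proof. by apply: part_antimono; case/and4P: skew. Qed.

Lemma box_in b : D (brow b) (bcol b).
Proof. exact: valP b. Qed.

Lemma diagram_bounds r c : D r c -> [&& 0 < r, r <= size lam, 0 < c & c <= part lam 1].
Proof.
rewrite /in_diagram => /andP[c1 c2].
have r0 : 0 < r by case: r c1 c2 => //; rewrite /part /=; lia.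
have -> : r <= size lam.
  by rewrite leqNgt; apply/negP=> lt_r; move: c2; rewrite /part nth_default //=; lia.
have := @lam_antimono 1 r; lia.
Qed.

Lemma boxP r c : D r c -> exists b, brow b = r :> nat /\ bcol b = c :> nat.
Proof.
move=> Drc; have /and4P[_ hr _ hc] := diagram_bounds Drc.
have hr' : r < (size lam).+1 by rewrite ltnS.
have hc' : c < (part lam 1).+1 by rewrite ltnS.
by exists (exist _ (Ordinal hr', Ordinal hc') Drc).
Qed.

Lemma ideal_left V b r c : ideal V -> b \in V -> brow b = r :> nat ->
  c <= bcol b -> D r c -> exists b', [/\ b' \in V, brow b' = r :> nat & bcol b' = c :> nat].
Proof.
move=> /idealP idV bV <- le_c /boxP[b' [er ec]]; exists b'; split=> //.
by apply: idV bV; apply: below_left; [apply: val_inj | rewrite ec].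
Qed.

Lemma ncols_ncol : ncols lam mu = ncol (setT : {set T}).
Proof.
rewrite /ncols /ncol cardE -(size_map val); apply/esym/perm_size/uniq_perm.
- by rewrite map_inj_uniq ?enum_uniq //; apply: val_inj.
- by rewrite filter_uniq ?iota_uniq.
move=> c; rewrite mem_filter mem_iota; apply/mapP/andP => [[c' + ->] | [+ hc]].
  rewrite mem_enum => /imsetP[b _ ->]; have Db := box_in b.
  have /and4P[r1 r2 c1 c2] := diagram_bounds Db; split; last by rewrite /=; lia.
  by apply/hasP; exists (brow b : nat); rewrite // mem_iota; lia.
case/hasP=> r _ /boxP[b [_ <-]]; exists (bcol b) => //.
by rewrite mem_enum; apply: imset_f; rewrite inE.
Qed.

Lemma mem_columns c : c \in columns lam mu <-> exists b, bcol b = c :> nat.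
Proof.
rewrite mem_filter; split=> [/andP[/hasP[r _ /boxP[b [_ <-]]] _] | [b <-]].
  by exists b.
have Db := box_in b; have /and4P[r1 r2 c1 c2] := diagram_bounds Db.
rewrite mem_iota; apply/andP; split; last by lia.
by apply/hasP; exists (brow b : nat); rewrite // mem_iota; lia.
Qed.

(** Connectedness in the form in which it is used: no vertical line separates
    the boxes into two parts without a common horizontal adjacency. *)
Definition cut_connected : Prop := forall c,
  (exists b, bcol b <= c) -> (exists b, c < bcol b) -> exists r, D r c /\ D r c.+1.

Lemma is_connected_cut : is_connected lam mu -> cut_connected.
Proof.
move=> conn c [b1 le1] [b2 lt2].
have [/hasP[r _ /andP[]]|/hasPn no] :=
  boolP (has (fun r => D r c && D r c.+1) (iota 0 (size lam).+1)); first by exists r.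
have clo : closed (@adjacent lam mu) [pred b | bcol b <= c].
  suff half b b' : brow b == brow b' -> bcol b' == (bcol b).+1 :> nat ->
      (bcol b <= c) = (bcol b' <= c).
    move=> b b'; rewrite /adjacent !inE => /orP[/andP[er /orP[ec|ec]]|/andP[/eqP-> _] //].
      by apply/esym/half => //; rewrite eq_sym.
    exact: half.
  move=> /eqP er /eqP ec; rewrite ec leq_eqVlt orbC.
  case: ltnP => //= ge; apply/negP=> /eqP e; subst c.
  have := no (brow b); rewrite mem_iota /= box_in -ec er box_in /=.
  by have := diagram_bounds (box_in b'); lia.
have := closed_connect clo (forallP (forallP conn b1) b2).
by rewrite !inE le1 leqNgt lt2.
Qed.

Lemma chains1 k : chains [:: ColLayer k] (set0 : {set T}) = (ncol (setT : {set T}) == k).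
Proof.
rewrite /= big_mkcond (bigD1 setT) //= big1; last first.
  by move=> W /negbTE nW; rewrite nW; case: ifP.
by rewrite /step idealT sub0set setD0 eqxx /= addn0; case: eqP.
Qed.

(** The ideals of boxes with value 1 in the fillings with values 1 and 2 that
    have monomial x_1^k x_2^l. *)
Definition two_layer_ideals k l : {set {set T}} :=
  [set V | [&& ideal V, ncol V == k & ncol (~: V) == l]].

Lemma chains2 k l :
  chains [:: ColLayer k; ColLayer l] (set0 : {set T}) = #|two_layer_ideals k l|.
Proof.
rewrite -sum1_card /= big_mkcond [RHS]big_mkcond; apply: eq_bigr => V _ /=.
rewrite inE /step sub0set setD0 /=; case: ideal => //=; case: eqP => //= _.
rewrite big_mkcond (bigD1 setT) //= big1; last first.
  by move=> W /negbTE nW; rewrite nW; case: ifP.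
by rewrite idealT subsetT setTD eqxx /= addn0; case: eqP.
Qed.

(** The columns meeting both V and its complement are the excess of the degree
    over the number of columns. *)
Lemma ncol_mixed V : #|(bcol (mu:=mu) @: V) :&: (bcol (mu:=mu) @: ~: V)| + ncol (setT : {set T})
  = ncol V + ncol (~: V).
Proof. by rewrite /ncol -(setUCr V) imsetU addnC cardsUI. Qed.

Lemma pure_columns V b b' : ncol V + ncol (~: V) = ncol (setT : {set T}) ->
  b \in V -> bcol b = bcol b' -> b' \in V.
Proof.
move=> e bV ec; have /eqP := ncol_mixed V; rewrite e -[X in _ == X]add0n eqn_add2r cards_eq0.
apply: contraTT => b'V; apply/set0Pn; exists (bcol b).
by rewrite inE imset_f // ec imset_f // inE.
Qed.

(** If every column has one value, then in a connected shape only the first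
    column can be the single one of value 1: a column to its left would share a
    row with it. *)
Lemma cut_connected_le1 : cut_connected ->
  #|two_layer_ideals 1 (ncol (setT : {set T})).-1| <= 1.
Proof.
move=> cut; pose F := [set b : T | [forall b' : T, bcol b <= bcol b']].
apply: (@leq_trans #|[set F]|); last by rewrite cards1.
apply/subset_leq_card/subsetP=> V; rewrite !inE => /and3P[idV /eqP c1 /eqP c2].
have n0 : 0 < ncol (setT : {set T}).
  by rewrite -c1; apply: subset_leq_card; apply: imsetS; apply: subsetT.
have pure b b' : b \in V -> bcol b = bcol b' -> b' \in V.
  by apply: pure_columns; rewrite c1 c2 add1n prednK.
have [x xE] := cards1P (introT eqP c1).
have colV b : b \in V -> bcol b = x.
  by move=> bV; apply/set1P; rewrite -xE imset_f.
have minV b : b \in V -> [forall b' : T, bcol b <= bcol b'].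
  move=> bV; apply/forallP=> b'; rewrite leqNgt; apply/negP=> lt.
  have [||r [D1 D2]] := cut (bcol b).-1; first by exists b'; lia.
    by exists b; lia.
  rewrite prednK in D2; last by lia.
  have [b2 [r2 e2]] := boxP D2.
  have b2V : b2 \in V by apply: (pure b) => //; apply: val_inj.
  have [|b1 [b1V _ e1]] := ideal_left idV b2V r2 _ D1; first by lia.
  by move: e1; rewrite (colV _ b1V) (colV _ bV); move: lt; rewrite (colV _ bV); lia.
apply/eqP/setP=> b; rewrite inE; apply/idP/idP => [/minV //|/forallP mb].
have : bcol (mu:=mu) @: V != set0 by rewrite -cards_eq0 [#|_|]c1.
case/set0Pn=> _ /imsetP[b0 b0V _]; apply: (pure b0) => //; apply: val_inj.
apply/eqP; rewrite eqn_leq mb andbT; exact: (forallP (minV _ b0V)).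
Qed.

Lemma column_ideal b0 : (forall b b', bcol b = bcol b0 -> brow b' = brow b -> 
    bcol b <= (bcol b').+1 -> bcol b' <= bcol b -> bcol b' = bcol b) ->
  [set b : T | bcol b == bcol b0] \in two_layer_ideals 1 (ncol (setT : {set T})).-1.
Proof.
move=> h; set V := [set b : T | _].
have colV : bcol (mu:=mu) @: V = [set bcol b0].
  apply/setP=> c; rewrite inE; apply/imsetP/eqP => [[b + ->]|->]; first by rewrite inE => /eqP.
  by exists b0; rewrite // inE.
rewrite inE; apply/and3P; split; last 2 first.
- by rewrite /ncol colV cards1.
- have := ncol_mixed V; rewrite {2}/ncol colV cards1 (_ : _ :&: _ = set0).
    by rewrite cards0 add0n add1n => ->.
  apply/setP=> c; rewrite !inE; apply/negP=> /andP[/eqP-> /imsetP[b + e]].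
  by rewrite !inE e eqxx.
apply/idealP=> b b'; rewrite !inE => + /eqP e.
case/orP=> /andP[/eqP er le]; last by rewrite er e.
have [//|ne] := eqVneq (bcol b) (bcol b0).
have lt : bcol b < bcol b' by rewrite ltn_neqAle le e andbT.
have Dc : D (brow b') (bcol b').-1.
  by have := box_in b'; have := box_in b; rewrite er /in_diagram; lia.
have [b2 [r2 c2]] := boxP Dc.
have h2 : bcol b2 = bcol b' by apply: h => //; [apply: val_inj | rewrite c2; lia..].
by move: c2; rewrite h2; lia.
Qed.

(** If a vertical line separates the shape, then both the first column and the
    first column to the right of this line are ideals. *)
Lemma le1_cut_connected :
  #|two_layer_ideals 1 (ncol (setT : {set T})).-1| <= 1 -> cut_connected.
Proof.
move=> le1 c ex1 ex2.
have [/hasP[r _ /andP[]]|/hasPn no] :=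
  boolP (has (fun r => D r c && D r c.+1) (iota 0 (size lam).+1)); first by exists r.
have {}no r : D r c -> D r c.+1 -> False.
  move=> D1 D2; have := no r; rewrite mem_iota D1 D2 /=.
  by have := diagram_bounds D1; lia.
case: ex1 => b1 le_b1; case: ex2 => b2 lt_b2.
have [m1 _ min1] := @arg_minnP _ b1 predT (fun b => bcol b : nat) isT.
have [m2 lt_m2 min2] := @arg_minnP _ b2 [pred b | c < bcol b] (fun b => bcol b : nat) lt_b2.
(* m1 is in the first column, m2 in the first one to the right of the line c. *)
have V1 : [set b : T | bcol b == bcol m1] \in two_layer_ideals 1 (ncol (setT : {set T})).-1.
  apply: column_ideal => b b' e _ _ le; apply: val_inj; apply/eqP.
  by rewrite eqn_leq le e min1.
have V2 : [set b : T | bcol b == bcol m2] \in two_layer_ideals 1 (ncol (setT : {set T})).-1.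
  apply: column_ideal => b b' e er le1' le2; apply: val_inj; apply/eqP.
  rewrite eqn_leq le2 e /=; have [lt|ge] := ltnP c (bcol b'); first exact: min2.
  have := box_in b'; have := box_in b; rewrite /= in lt_m2; rewrite er => Db Db'; exfalso.
  have ec : bcol b' = c :> nat by move: le1' ge; rewrite e; lia.
  have ec1 : c.+1 = bcol b by move: lt_m2 le1'; rewrite e; lia.
  by apply: (no (brow b)); [rewrite -ec | rewrite ec1].
have := subset_leq_card (_ : [set [set b : T | bcol b == bcol m1]; [set b : T | bcol b == bcol m2]]
   \subset two_layer_ideals 1 (ncol (setT : {set T})).-1).
rewrite subUset !sub1set V1 V2 => /(_ isT) /leq_trans/(_ le1).
rewrite cards2; case: eqP => //= /setP/(_ m2); rewrite !inE eqxx.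
by move=> /eqP e; have := min1 b1 isT; rewrite /= in lt_m2; rewrite -e; lia.
Qed.

(** In a connected shape the nonempty columns are consecutive; s is the number
    of empty columns on their left. *)
Lemma columns_interval : cut_connected -> exists s,
  [/\ forall b, s < bcol b <= s + ncols lam mu,
      forall c, s < c <= s + ncols lam mu -> exists b, bcol b = c :> nat
    & forall i, 0 < i <= ncols lam mu -> column lam mu i = s + i].
Proof.
move=> cut; have [e0|] := set_0Vmem (setT : {set T}).
  have n0 : ncols lam mu = 0 by rewrite ncols_ncol e0 /ncol imset0 cards0.
  exists 0; rewrite n0; split=> [b|c|i]; last by lia.
    by have := in_setT b; rewrite e0 inE.
  by lia.
case=> b0 _.
have [m1 _ min1] := @arg_minnP _ b0 predT (fun b => bcol b : nat) isT.
have [m2 _ max2] := @arg_maxnP _ b0 predT (fun b => bcol b : nat) isT.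
have m1_gt0 : 0 < bcol m1 by have := diagram_bounds (box_in m1); lia.
have le12 : bcol m1 <= bcol m2 by exact: max2.
have eC : columns lam mu = iota (bcol m1) ((bcol m2).+1 - bcol m1).
  apply: (irr_sorted_eq ltn_trans ltnn); rewrite ?iota_ltn_sorted //.
    by rewrite sorted_filter ?iota_ltn_sorted //; apply: ltn_trans.
  move=> c; rewrite mem_iota subnKC; last by lia.
  apply/idP/idP => [/mem_columns[b <-]|/andP[le1 le2]].
    by rewrite min1 // ltnS; apply: max2.
  apply/mem_columns; have [e|ne] := eqVneq c (bcol m2 : nat); first by exists m2.
  have [||r [/boxP[b [_ e]] _]] := cut c; [by exists m1 | by exists m2; lia|].
  by exists b.
have en : ncols lam mu = (bcol m2).+1 - bcol m1 by rewrite /ncols eC size_iota.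
exists (bcol m1).-1; rewrite en; split=> [b|c hc|i hi].
- have := min1 b isT; have : bcol b <= bcol m2 by exact: max2.
  by lia.
- by apply/mem_columns; rewrite eC mem_iota; lia.
- by rewrite /column eC nth_iota; lia.
Qed.

End Geometry.

(** * Two values, one mixed column *)

(** For 1 <= k, p <= n, this is the number of pairs (x, y) with
    0 <= x <= p - 1, 0 <= y <= n - p and x + y = k - 1. *)
Definition tent (n k p : nat) : nat := minn (minn k (n.+1 - k)) (minn p (n.+1 - p)).

Lemma card_ord_interval N lo hi : hi <= N -> #|[set c : 'I_N | lo <= c < hi]| = hi - lo.
Proof.
move=> hiN; rewrite -[RHS](size_iota lo) cardE -(size_map val).
apply/perm_size/uniq_perm.
- by rewrite map_inj_uniq ?enum_uniq //; apply: val_inj.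
- exact: iota_uniq.
move=> c; rewrite mem_iota; apply/mapP/idP => [[c' + ->]|hc].
  by rewrite mem_enum inE /=; lia.
have hN : c < N by lia.
by exists (Ordinal hN); rewrite // mem_enum inE /=; lia.
Qed.

Section CutRow.
Variables (s n k m q : nat).
Hypothesis hk : 0 < k <= n.
Let N := (s + n).+1.

(** The pairs (i, a) for which [cut_ideal] has mixed column i, changes value
    below the given row, and meets k columns.  The numbers m and q stand for
    part mu r and part lam r.+1, and the last column t of value 1, or i if
    there is none to the right of i, is expressed by k, i and a. *)
Definition row_cuts : {set 'I_N * 'I_N} :=
  [set y : 'I_N * 'I_N | [&& m < y.1 <= q, s <= y.2 < y.1, y.1 <= k + s + y.1 - y.2.+1 <= s + n,
     (y.2.+1 == y.1) || (y.1 == m.+1 :> nat)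
     & (k + s + y.1 - y.2.+1 == y.1) || (y.1 == q :> nat)]].

(** If m + 1 < q, then i is k + s moved into the interval from m + 1 to q, and
    everything else is forced.  If m + 1 = q, then i = q, and a is only
    bounded by a >= s, t <= s + n, and the equation for k. *)
Lemma card_row_cuts : (m < q -> s <= m /\ q <= s + n) ->
  #|row_cuts| = (m.+1 < q) + (m.+1 == q) * tent n k (m.+1 - s).
Proof.
move=> hmq; have [lt_mq|le_qm] := ltnP m q; last first.
  rewrite (_ : row_cuts = set0) ?cards0; first by lia.
  by apply/setP=> y; rewrite !inE; apply/negP; lia.
have [sm qn] := hmq lt_mq; have [lt|ge] := ltnP m.+1 q.
  rewrite (_ : (m.+1 == q) = false) ?addn0; last by lia.
  have hi : maxn m.+1 (minn q (k + s)) < N by rewrite /N; lia.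
  have ha : (minn (maxn m.+1 (minn q (k + s))) (k + s)).-1 < N by rewrite /N; lia.
  rewrite (_ : row_cuts = [set (Ordinal hi, Ordinal ha)]) ?cards1 //.
  apply/setP=> -[i a]; rewrite !inE xpair_eqE -!(inj_eq val_inj) /=.
  move: (i : nat) (a : nat) => {hi ha} {}i {}a.
  have [h1|h1] := leqP (k + s) m.+1; last have [h2|h2] := ltnP (k + s) q.
  - by apply/idP/idP; lia.
  - by apply/idP/idP; lia.
  - by apply/idP/idP; lia.
have eq : m.+1 = q by lia.
rewrite eq eqxx mul1n.
have hq : q < N by rewrite /N; lia.
rewrite (_ : row_cuts =
  setX [set Ordinal hq] [set a : 'I_N | maxn s (k + q - n.+1) <= a < minn q (k + s)]).
  rewrite cardsX cards1 mul1n card_ord_interval /N; last by lia.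
  by rewrite /tent; lia.
apply/setP=> -[i a]; rewrite !inE -(inj_eq val_inj) /=.
move: (i : nat) (a : nat) => {}i {}a.
by apply/idP/idP; lia.
Qed.

End CutRow.

Section OneMixedColumn.
Variables (lam mu : seq nat) (s n : nat).
Hypothesis skew : is_skew lam mu.
Local Notation T := (box lam mu).
Local Notation D := (in_diagram lam mu).
Implicit Types (b : T) (U V W S : {set T}).
Hypothesis col_range : forall b, s < bcol b <= s + n.
Hypothesis col_exists : forall c, s < c <= s + n -> exists b, bcol b = c :> nat.
Hypothesis cut : forall c, s < c < s + n -> exists r, D r c /\ D r c.+1.

Lemma col_bound : 0 < n -> s + n <= part lam 1.
Proof.
move=> n0; have [|b <-] := @col_exists (s + n); first by lia.
by have := diagram_bounds skew (box_in b); lia.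
Qed.

(** The value 1 occurs in two runs of columns, and so does the value 2. *)
Lemma ncol_intervals S x1 y1 x2 y2 : x1 <= y1 <= x2 -> x2 <= y2 <= s + n ->
  (forall b, b \in S -> (x1 < bcol b <= y1) || (x2 < bcol b <= y2)) ->
  (forall c, (x1 < c <= y1) || (x2 < c <= y2) -> exists2 b, b \in S & bcol b = c :> nat) ->
  ncol S = (y1 - x1) + (y2 - x2).
Proof.
move=> h1 h2 sub sup; have [n0|n0] := posnP n.
  rewrite /ncol (_ : _ @: S = set0) ?cards0; last first.
    apply/setP=> c; rewrite inE; apply/imsetP=> -[b _ _].
    by have := col_range b; rewrite n0; lia.
  have [|le1] := ltnP x1 y1.
    move=> lt; have [|b _ _] := sup y1; first by lia.
    by have := col_range b; rewrite n0; lia.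
  have [lt|] := ltnP x2 y2; last by lia.
  have [|b _ _] := sup y2; first by lia.
  by have := col_range b; rewrite n0; lia.
have leC := col_bound n0; set N := (part lam 1).+1.
rewrite -[y1 - x1]subSS -[y2 - x2]subSS.
rewrite -(@card_ord_interval N x1.+1 y1.+1) ?/N; last by lia.
rewrite -(@card_ord_interval N x2.+1 y2.+1) ?/N; last by lia.
rewrite -cardsUI [X in _ = _ + X](_ : _ = 0) ?addn0; last first.
  by apply/eqP; rewrite cards_eq0; apply/eqP/setP=> c; rewrite !inE; lia.
congr #|pred_of_set _|; apply/setP=> c; rewrite !inE !ltnS.
apply/imsetP/idP => [[b bS ->]|]; first exact: sub.
by case/sup=> b bS e; exists b => //; apply: val_inj.
Qed.

(** The general ideal with exactly one mixed column i: it changes value below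
    row r, and on either side of i the columns of value 1 come first, up to
    column a on the left and up to column t on the right. *)
Definition cut_ideal r i a t : {set T} :=
  [set b : T | if bcol b < i then bcol b <= a
               else if bcol b == i :> nat then brow b <= r else bcol b <= t].

Definition cut_shape r i a t : bool :=
  [&& 0 < r, part mu r < i <= part lam r.+1, s <= a < i & i <= t <= s + n].

(** Columns of value 2 directly to the left of i are possible only if column
    i - 1 does not reach row r, which means that the edge below (r, i) touches
    the left boundary; similarly for columns of value 1 to the right of i. *)
Definition cut_valid r i a t : bool :=
  [&& cut_shape r i a t, (a.+1 == i) || (i == (part mu r).+1)
    & (t == i) || (i == part lam r.+1)].

Lemma cut_boxes r i : 0 < r -> part mu r < i <= part lam r.+1 -> D r i /\ D r.+1 i.
Proof.
move=> r0 hi; have := @lam_antimono _ _ skew r r.+1.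
by have := @mu_antimono _ _ skew r r.+1; rewrite /in_diagram; lia.
Qed.

Lemma cut_ideal_ideal r i a t : cut_valid r i a t -> ideal (cut_ideal r i a t).
Proof.
case/and3P=> /and4P[r0 hi ha hb] va vb; apply/idealP=> b1 b2.
have D1 := box_in b1; have D2 := box_in b2.
have /and4P[r1 _ _ _] := diagram_bounds skew D1.
have /and4P[r2 _ _ _] := diagram_bounds skew D2.
rewrite !inE => /orP[]/andP[/eqP e le]; last first.
  by rewrite e; case: ifP => // _; case: ifP => // _; apply: leq_trans.
rewrite e in D1.
have Hm := @mu_antimono _ _ skew (brow b2) r.
have Hl := @lam_antimono _ _ skew r.+1 (brow b2).
rewrite e; move: D1 D2; rewrite /in_diagram => /andP[m1 l1] /andP[m2 l2].
case: (ltngtP (bcol b2) i) => [lt2|gt2|e2] h2; case: (ltngtP (bcol b1) i) => [lt1|gt1|e1];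
  try lia.
Qed.

Lemma ncol_cut_ideal r i a t : cut_shape r i a t ->
  ncol (cut_ideal r i a t) = (a - s) + (t - i.-1).
Proof.
case/and4P=> r0 hi ha hb; have [Dr Dr1] := cut_boxes r0 hi.
apply: ncol_intervals => [||b|c hc]; [lia | lia | |].
  by have := col_range b; rewrite inE; case: (ltngtP (bcol b) i); lia.
have [e|ne] := eqVneq c i.
  have [b [er ec]] := boxP skew Dr; exists b; last by rewrite ec.
  by rewrite inE ec ltnn eqxx er.
have [|b ec] := @col_exists c; first by lia.
by exists b => //; rewrite inE ec; case: (ltngtP c i) ne hc => //; lia.
Qed.

Lemma ncol_cut_idealC r i a t : cut_shape r i a t ->
  ncol (~: cut_ideal r i a t) = (i - a) + (s + n - t).
Proof.
case/and4P=> r0 hi ha hb; have [Dr Dr1] := cut_boxes r0 hi.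
apply: ncol_intervals => [||b|c hc]; [lia | lia | |].
  by have := col_range b; rewrite !inE; case: (ltngtP (bcol b) i); lia.
have [e|ne] := eqVneq c i.
  have [b [er ec]] := boxP skew Dr1; exists b; last by rewrite ec.
  by rewrite !inE ec ltnn eqxx er ltnn.
have [|b ec] := @col_exists c; first by lia.
by exists b => //; rewrite !inE ec; case: (ltngtP c i) ne hc => //; lia.
Qed.

(** Away from the mixed column every column has a single value, and two
    adjacent columns share a row, so a column of value 2 is never followed by
    one of value 1 on the same side of the mixed column. *)
Lemma mixed_column_cut V k : 0 < k <= n -> V \in two_layer_ideals lam mu k (n.+1 - k) ->
  exists r i a t, [/\ cut_valid r i a t, r < size lam & V = cut_ideal r i a t].
Proof.
move=> hk; rewrite inE => /and3P[idV /eqP kV /eqP lV].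
have nT : ncol (setT : {set T}) = n.
  rewrite (@ncol_intervals _ s (s + n) (s + n) (s + n)); [lia|lia|lia|move=> b _; have := col_range b; lia|].
  by move=> c hc; have [|b e] := @col_exists c; [lia | exists b; rewrite ?inE].
have := ncol_mixed V; rewrite kV lV nT => e.
have /cards1P[x xE] : #|(bcol (mu:=mu) @: V) :&: (bcol (mu:=mu) @: ~: V)| == 1 by apply/eqP; lia.
have : x \in (bcol (mu:=mu) @: V) :&: (bcol (mu:=mu) @: ~: V) by rewrite xE set11.
rewrite inE => /andP[/imsetP[bV inV eV] /imsetP[bN]]; rewrite inE => notV eN.
have pure b1 b2 : b1 \in V -> b2 \notin V -> bcol b1 = bcol b2 -> bcol b1 = x.
  move=> h1 h2 e12; apply/set1P; rewrite -xE inE imset_f //= e12 imset_f // inE //.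
have [bm /andP[mV /eqP mx] maxm] := @arg_maxnP _ bV [pred b | (b \in V) && (bcol b == x)]
   (fun b => brow b : nat) (introT andP (conj inV (introT eqP (esym eV)))).
(* The cut is below the lowest box of V in the mixed column. *)
set r : nat := brow bm in maxm; set i : nat := x.
have below_m b : bcol b = x -> brow b <= r -> b \in V.
  by move=> ec le; apply: (idealP _ idV _ _ _ mV); apply: below_up; rewrite ?ec.
have lt_rN : r < brow bN.
  by rewrite ltnNge; apply: contra notV; apply: below_m.
have Dm : D r i by rewrite /r /i -mx; apply: box_in.
have DN : D (brow bN) i by rewrite /i eN; apply: box_in.
have r0 : 0 < r by have := diagram_bounds skew Dm; lia.
have hr : r < size lam by have := diagram_bounds skew DN; lia.
have hi : part mu r < i <= part lam r.+1.
  by have := @lam_antimono _ _ skew r.+1 (brow bN); move: Dm DN; rewrite /in_diagram; lia.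
have hsi : s < i <= s + n by rewrite /i -mx.
have [Dr Dr1] := cut_boxes r0 hi.
pose inc c := [exists b in V, bcol b == c :> nat].
have incP b c : bcol b = c :> nat -> c != i -> inc c -> b \in V.
  move=> ec ne /exists_inP[b1 b1V /eqP e1]; apply: contraNT ne => bV'.
  by rewrite /i -(pure b1 b) // ?e1 //; apply: val_inj; rewrite /= e1 ec.
have down c : s < c -> c.+1 != i -> inc c.+1 -> inc c.
  move=> sc ne ic; have /exists_inP[b1 b1V /eqP e1] := ic.
  have [|r' [D1 D2]] := @cut c; first by have := col_range b1; rewrite e1; clear -sc; lia.
  have [b2 [r2 e2]] := boxP skew D2; have b2V := incP _ _ e2 ne ic.
  have [|b3 [b3V _ e3]] := ideal_left skew idV b2V r2 _ D1; first by rewrite e2.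
  by apply/exists_inP; exists b3; rewrite ?e3.
have downs d c : s < c -> (forall e, c < e <= c + d -> e != i) -> inc (c + d) -> inc c.
  move=> sc; elim: d => [|d IH] ne; first by rewrite addn0.
  rewrite addnS => /down h; apply: IH => [e' he'|].
    by apply: ne; clear -he'; lia.
  by apply: h; [clear -sc; lia | apply: ne; clear; lia].
(* Here a = s stands for having no column of value 1 to the left of i. *)
have [||a /andP[ha /orP ca] maxa] := @ex_maxnP (fun c => (s <= c < i) && ((c == s) || inc c)) i.
- by exists s; rewrite eqxx; clear -hsi; lia.
- by move=> c; clear; lia.
have [||t /andP[hb /orP cb] maxb] :=
    @ex_maxnP (fun c => (i <= c <= s + n) && ((c == i) || inc c)) (s + n).
- by exists i; rewrite eqxx; clear -hsi; lia.
- by move=> c; clear; lia.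
have VE : V = cut_ideal r i a t.
  apply/setP=> b; rewrite inE; have hb0 := col_range b.
  have incV : b \in V -> inc (bcol b) by move=> bV'; apply/exists_inP; exists b.
  case: (ltngtP (bcol b) i) => hbi.
  - apply/idP/idP => [/incV h|le]; first by apply: maxa; rewrite h orbT; clear -hb0 hbi; lia.
    apply: (incP b (bcol b)) => //; first by clear -hbi; lia.
    case: ca => [/eqP|]; first by clear -hb0 le; lia.
    by move=> h; apply: (@downs (a - bcol b)); rewrite ?subnKC //; clear -hb0 hbi ha; lia.
  - apply/idP/idP => [/incV h|le]; first by apply: maxb; rewrite h orbT; clear -hb0 hbi; lia.
    apply: (incP b (bcol b)) => //; first by clear -hbi; lia.
    case: cb => [/eqP|]; first by clear -hbi le; lia.
    by move=> h; apply: (@downs (t - bcol b)); rewrite ?subnKC //; clear -hb0 hbi; lia.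
  - apply/idP/idP => [bV'|]; last by apply: below_m; apply: val_inj.
    by apply: maxm; rewrite inE /= bV'; apply/eqP/val_inj.
exists r, i, a, t; split=> //; rewrite /cut_valid /cut_shape r0 hi ha hb /=.
apply/andP; split.
- rewrite -implyNb; apply/implyP=> na; apply/negPn/negP=> ni.
  have D1 : D r i.-1 by move: Dr; rewrite /in_diagram; clear -ni hi; lia.
  have [|b1 [b1V r1 e1]] := ideal_left skew idV mV (erefl _) _ D1; first by rewrite mx; apply: leq_pred.
  by move: b1V; rewrite VE inE e1; clear -na ha; case: ltngtP; lia.
- rewrite -implyNb; apply/implyP=> nb; apply/negPn/negP=> ni.
  have D1 : D r.+1 i.+1.
    by have := @mu_antimono _ _ skew r r.+1; rewrite /in_diagram; clear -ni hi r0; lia.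
  have [b1 [r1 e1]] := boxP skew D1.
  have b1V : b1 \in V by rewrite VE inE e1; clear -nb hb; case: ltngtP; lia.
  have [|b2 [b2V r2 e2]] := ideal_left skew idV b1V r1 _ Dr1; first by rewrite e1.
  by move: b2V; rewrite VE inE e2 ltnn eqxx r2 ltnn.
Qed.

Lemma cut_ideal_inj r1 i1 a1 t1 r2 i2 a2 t2 :
  cut_shape r1 i1 a1 t1 -> cut_shape r2 i2 a2 t2 ->
  cut_ideal r1 i1 a1 t1 = cut_ideal r2 i2 a2 t2 -> [/\ r1 = r2, i1 = i2 & a1 = a2].
Proof.
move=> /and4P[r1_0 hi1 ha1 hb1] /and4P[r2_0 hi2 ha2 hb2] /setP eV.
have [D1 D1'] := cut_boxes r1_0 hi1; have [D2 D2'] := cut_boxes r2_0 hi2.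
have ei : i1 = i2.
  have [b [er ec]] := boxP skew D1; have [b' [er' ec']] := boxP skew D1'.
  have := eV b; have := eV b'; rewrite !inE er er' ec ec' ltnn eqxx leqnn ltnn.
  by case: (ltngtP i1 i2) => // _ <-.
subst i2; split=> //.
- apply/eqP; rewrite eqn_leq; apply/andP; split.
    have [b [er ec]] := boxP skew D1; have := eV b.
    by rewrite !inE er ec ltnn eqxx leqnn => <-.
  have [b [er ec]] := boxP skew D2; have := eV b.
  by rewrite !inE er ec ltnn eqxx leqnn => ->.
have half a a' : s <= a < i1 -> s <= a' ->
    (forall b, bcol b < i1 -> bcol b <= a -> bcol b <= a') -> a <= a'.
  move=> ha ha' h; have [-> //|ne] := eqVneq a s.
  have [|b ec] := @col_exists a; first by lia.
  by have := h b; rewrite ec; apply; lia.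
have agree b : bcol b < i1 -> (bcol b <= a1) = (bcol b <= a2).
  by move=> lt; have := eV b; rewrite !inE lt.
have /andP[sa1 _] := ha1; have /andP[sa2 _] := ha2.
apply/eqP; rewrite eqn_leq; apply/andP; split; apply: half => // b lt_b.
  by rewrite agree.
by rewrite -agree.
Qed.

(** Rows r and r + 1 share the columns from part mu r + 1 to part lam r.+1. *)
Lemma card_two_layer_ideals k : 0 < k <= n ->
  #|two_layer_ideals lam mu k (n.+1 - k)| =
  \sum_(1 <= r < size lam)
     (((part mu r).+1 < part lam r.+1) +
      ((part mu r).+1 == part lam r.+1) * tent n k ((part mu r).+1 - s)).
Proof.
move=> hk; pose N := (s + n).+1.
(* The last column of value 1 is forced by the number k of columns. *)
pose right (i a : 'I_N) := k + s + i - a.+1.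
pose I := [set x : 'I_(size lam) * ('I_N * 'I_N) |
             cut_valid x.1 x.2.1 x.2.2 (right x.2.1 x.2.2)].
pose F (x : 'I_(size lam) * ('I_N * 'I_N)) :=
  cut_ideal x.1 x.2.1 x.2.2 (right x.2.1 x.2.2).
have injF : {in I &, injective F}.
  move=> [r1 [i1 a1]] [r2 [i2 a2]]; rewrite !inE => /and3P[sh1 _ _] /and3P[sh2 _ _].
  by case/(cut_ideal_inj sh1 sh2) => /= /val_inj-> /val_inj-> /val_inj->.
have -> : two_layer_ideals lam mu k (n.+1 - k) = F @: I.
  apply/setP=> V; apply/idP/imsetP => [VB | [[r [i a]] + ->]]; last first.
    rewrite inE /F /right => vd; have /and3P[sh _ _] := vd.
    rewrite inE cut_ideal_ideal // ncol_cut_ideal // ncol_cut_idealC //.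
    by case/and4P: sh => _ _ /= h1 h2; lia.
  have [r [i [a [t [vd hr eV]]]]] := mixed_column_cut hk VB.
  have /and3P[sh _ _] := vd; have /and4P[_ _ h1 h2] := sh.
  have hi : i < N by rewrite /N; lia.
  have ha : a < N by rewrite /N; lia.
  have et : t = right (Ordinal hi) (Ordinal ha).
    move: VB; rewrite inE eV ncol_cut_ideal // /right /= => /and3P[_ /eqP h3 _].
    by move: h1 h2 h3 hk; clear; lia.
  by exists (Ordinal hr, (Ordinal hi, Ordinal ha)); rewrite ?inE /= /F -et.
rewrite card_in_imset //.
pose J r := #|[set y : 'I_N * 'I_N | cut_valid r y.1 y.2 (right y.1 y.2)]|.
transitivity (\sum_(0 <= r < size lam) J r).
  rewrite big_mkord -sum1_card big_mkcond /=.
  rewrite (eq_bigr (fun x => if (x.1, x.2) \in I then 1 else 0)); last by case.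
  rewrite -(pair_bigA _ (fun r y => if (r, y) \in I then 1 else 0)) /=.
  apply: eq_bigr => r _; rewrite /J -sum1_card [RHS]big_mkcond /=.
  by apply: eq_bigr => y _; rewrite !inE.
have [->|lam0] := posnP (size lam); first by rewrite !big_geq.
rewrite big_ltn // (_ : J 0 = 0) ?add0n; last first.
  by apply/eqP; rewrite cards_eq0; apply/eqP/setP=> y; rewrite !inE.
apply: eq_big_nat => r /andP[r0 _].
rewrite -(@card_row_cuts s n k) //; last first.
  move=> lt; have [D1 _] := @cut_boxes r (part mu r).+1 r0 (introT andP (conj (ltnSn _) lt)).
  have [|_ D2] := @cut_boxes r (part lam r.+1) r0; first by rewrite lt leqnn.
  have [b1 [_ e1]] := boxP skew D1; have [b2 [_ e2]] := boxP skew D2.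
  have := col_range b1; have := col_range b2; rewrite e1 e2; clear; lia.
rewrite /J /row_cuts; congr #|pred_of_set _|; apply/setP=> y.
by rewrite !inE /cut_valid /cut_shape /right r0 /= -!andbA.
Qed.

End OneMixedColumn.

(** * Row overlaps *)

Section RowOverlaps.
Variables lam mu : seq nat.
Hypothesis skew : is_skew lam mu.
Local Notation T := (box lam mu).
Local Notation D := (in_diagram lam mu).
Implicit Types (b : T) (U V W S : {set T}).

(** The number of r such that rows r and r + 1 share more than j columns. *)
Definition overlaps j : nat := \sum_(1 <= r < size lam) (part mu r + j < part lam r.+1).

(** Indexed by the lower of the two rows, which is the row where the overlap
    remains once the top boxes of all columns have been removed. *)
Definition overlap_rows j : {set 'I_(size lam).+1} :=
  [set r : 'I_(size lam).+1 | (1 < r) && (part mu r.-1 + j < part lam r)].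

Lemma card_overlap_rows j : #|overlap_rows j| = overlaps j.
Proof.
rewrite -sum1_card big_mkcond /=.
transitivity (\sum_(0 <= r < (size lam).+1) ((1 < r) && (part mu r.-1 + j < part lam r))).
  by rewrite big_mkord; apply: eq_bigr => r _; rewrite inE; case: ifP.
rewrite big_nat_recl //= add0n.
have [e0|n0] := posnP (size lam); first by rewrite /overlaps e0 !big_geq.
by rewrite big_ltn // add0n; apply: eq_big_nat => r /andP[r0 _]; rewrite ltnS r0.
Qed.

Lemma chains_cons_neq0 x w U : chains (x :: w) U != 0 ->
  exists2 W, step x U W & chains w W != 0.
Proof.
rewrite /= sum_nat_eq0 negb_forall => /existsP[W].
by rewrite negb_imply => /andP[sW nz]; exists W.
Qed.

Lemma chains_cons_gt0 x w U W : step x U W -> 0 < chains w W -> 0 < chains (x :: w) U.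
Proof.
move=> sW pos; rewrite /= lt0n sum_nat_eq0 negb_forall; apply/existsP; exists W.
by rewrite negb_imply sW -lt0n.
Qed.

(** A horizontal strip that meets every column removes all top boxes, so
    row r keeps at most its overlap with row r - 1.  A vertical strip with
    as many boxes as there are nonempty overlaps takes one box of each of them,
    so a further vertical strip needs overlaps of size two. *)
Lemma overlaps_bound k w :
  chains [:: HStrip (ncol (setT : {set T})), VStrip (overlaps 0), VStrip k & w]
    (set0 : {set T}) != 0 -> k <= overlaps 1.
Proof.
case/chains_cons_neq0=> U1 /and3P[id1 _]; rewrite setD0 => /andP[/eqP n1 /eqP c1].
case/chains_cons_neq0=> U2 /and3P[id2 U12 /andP[/eqP r2 _]].
case/chains_cons_neq0=> U3 /and3P[_ U23 /andP[/eqP r3 _]] _.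
have above b : b \notin U1 -> 1 < brow b /\ D (brow b).-1 (bcol b).
  move=> bU1; have : bcol b \in bcol (mu:=mu) @: U1.
    have /eqP-> : bcol (mu:=mu) @: U1 == bcol (mu:=mu) @: setT.
      by rewrite eqEcard imsetS ?subsetT //= -[X in X <= _]/(ncol setT) -n1.
    by rewrite imset_f ?inE.
  case/imsetP=> b' b'U e; have lt : brow b' < brow b.
    rewrite ltnNge; apply: contra bU1 => le.
    by apply: (idealP _ id1 _ _ _ b'U); apply: below_up.
  have := box_in b'; rewrite -e; have := box_in b; rewrite /in_diagram.
  have /and4P[r0 _ _ _] := diagram_bounds skew (box_in b').
  have := @mu_antimono _ _ skew (brow b') (brow b).-1.
  have := @lam_antimono _ _ skew (brow b).-1 (brow b).
  by move: r0 lt; clear; lia.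
have over b : b \notin U1 ->
    [/\ 1 < brow b, part mu (brow b).-1 < bcol b & bcol b <= part lam (brow b)].
  by case/above=> -> /andP[-> _]; case/andP: (box_in b).
have rows2 : brow (mu:=mu) @: (U2 :\: U1) = overlap_rows 0.
  apply/eqP; rewrite eqEcard card_overlap_rows -r2 leqnn andbT.
  apply/subsetP=> _ /imsetP[b + ->]; rewrite !inE => /andP[/over[-> h1 h2] _] /=.
  by rewrite addn0 (leq_trans h1).
rewrite -r3 -card_overlap_rows; apply/subset_leq_card/subsetP=> _ /imsetP[b + ->].
rewrite inE => /andP[bU2 _]; have bU1 : b \notin U1 by apply: contra bU2; apply/subsetP.
have [lt1 h1 h2] := over b bU1.
have : brow b \in overlap_rows 0 by rewrite inE lt1 addn0 (leq_trans h1).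
rewrite -rows2 => /imsetP[b2]; rewrite inE => /andP[b2U1 b2U2] er.
have [_ h3 h4] := over b2 b2U1; rewrite -er in h3 h4.
have : bcol b != bcol b2 :> nat.
  by apply: contraNneq bU2 => /val_inj ec; rewrite (box_inj er ec).
by rewrite inE lt1; move: h1 h2 h3 h4; clear; lia.
Qed.

(** With j = 0 these are the top boxes of all columns; each increment of j adds
    the next box in every row below.  The first row is a separate case because
    part mu 0 is 0 instead of infinity. *)
Definition top_boxes j : {set T} :=
  [set b : T | (brow b <= 1) || (bcol b <= part mu (brow b).-1 + j)].

Lemma top_boxes_ideal j : ideal (top_boxes j).
Proof.
apply/idealP=> b b'; rewrite !inE; case/orP=> /andP[/eqP e le].
  by rewrite e => /orP[->//|h]; rewrite (leq_trans le h) orbT.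
rewrite e; have /and4P[r0 _ _ _] := diagram_bounds skew (box_in b).
have [//|lt1] := leqP (brow b) 1; rewrite /= => h.
have := @mu_antimono _ _ skew (brow b).-1 (brow b').-1.
by move: lt1 le h; clear; lia.
Qed.

Lemma step_top0 : step (HStrip (ncol (setT : {set T}))) set0 (top_boxes 0).
Proof.
have cE : ncol (top_boxes 0) = ncol (setT : {set T}).
  congr #|pred_of_set _|; apply/eqP; rewrite eqEsubset imsetS ?subsetT //=.
  apply/subsetP=> _ /imsetP[b _ ->].
  have [b0 /eqP e0 min0] := @arg_minnP _ b [pred b' | bcol b' == bcol b]
    (fun b' => brow b' : nat) (eqxx _).
  rewrite -e0; apply: imset_f; rewrite inE addn0.
  have [//|lt1] := leqP (brow b0) 1; rewrite /= leqNgt; apply/negP=> lt_mu.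
  have [|b' [er ec]] := @boxP _ _ skew (brow b0).-1 (bcol b0).
    have := @lam_antimono _ _ skew (brow b0).-1 (brow b0).
    have := box_in b0; rewrite /in_diagram; move: lt1 lt_mu; clear; lia.
  have := min0 b'; rewrite inE /= er -e0 (val_inj ec) eqxx => /(_ isT).
  by move: lt1; clear; lia.
rewrite /step top_boxes_ideal sub0set setD0 is_HStripE cE.
suff /ncol_cardP e : {in top_boxes 0 &, injective (@bcol lam mu)}.
  by rewrite -cE e (eqP e) eqxx.
suff lt b b' : b' \in top_boxes 0 -> bcol b = bcol b' -> ~~ (brow b < brow b').
  move=> b b' bT b'T ec; apply: box_inj => //; apply: val_inj; apply/eqP.
  by rewrite eqn_leq leqNgt (lt b' b) //= leqNgt lt.
rewrite inE addn0 => h ec; apply/negP=> lt.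
have /and4P[r0 _ _ _] := diagram_bounds skew (box_in b).
have := @mu_antimono _ _ skew (brow b) (brow b').-1; have := box_in b.
by rewrite /in_diagram ec; move: h lt r0; clear; lia.
Qed.

Lemma step_top j : step (VStrip (overlaps j)) (top_boxes j) (top_boxes j.+1).
Proof.
rewrite /step top_boxes_ideal is_VStripE; apply/and3P; split=> //.
  by apply/subsetP=> b; rewrite !inE => /orP[->//|h]; rewrite (leq_trans h) ?orbT ?leq_add2l.
have inD b : b \in top_boxes j.+1 :\: top_boxes j ->
    1 < brow b /\ bcol b = (part mu (brow b).-1 + j).+1 :> nat.
  by rewrite !inE; clear; lia.
have e : nrow (top_boxes j.+1 :\: top_boxes j) == #|top_boxes j.+1 :\: top_boxes j|.
  apply/nrow_cardP=> b b' /inD[_ e1] /inD[_ e2] er; apply: box_inj => //.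
  by apply: val_inj; rewrite /= e1 e2 er.
rewrite e -(eqP e) -card_overlap_rows; apply/eqP; congr #|pred_of_set _|.
apply/setP=> r; rewrite [RHS]inE; apply/imsetP/andP => [[b /inD[lt1 e1] ->]|[lt1 lt2]].
  by split=> //; rewrite -e1; case/andP: (box_in b).
have [|b [er ec]] := @boxP _ _ skew r (part mu r.-1 + j).+1.
  have := @mu_antimono _ _ skew r.-1 r; rewrite /in_diagram.
  by move: lt1 lt2; clear; lia.
exists b; last exact: val_inj.
rewrite !inE er ec addnS leqnn orbT andbT.
by move: lt1; clear; lia.
Qed.

(** The successive layers of [top_boxes] are the extremal strips. *)
Lemma overlaps_attained : exists2 w, all is_strip w &
  0 < chains [:: HStrip (ncol (setT : {set T})), VStrip (overlaps 0), VStrip (overlaps 1) & w]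
    (set0 : {set T}).
Proof.
exists (nseq #|~: top_boxes 2| (HStrip 1)); first by rewrite all_nseq orbT.
apply: chains_cons_gt0 step_top0 _; apply: chains_cons_gt0 (step_top 0) _.
by apply: chains_cons_gt0 (step_top 1) _; apply: chains_singletons (top_boxes_ideal 2).
Qed.

End RowOverlaps.

(** Among the words starting with H_n E_m, where n is the number of columns and
    m the number of nonempty overlaps, the largest k for which E_k can follow
    is the same for both shapes. *)
Lemma overlaps_le lam mu gam nu : is_skew lam mu -> is_skew gam nu ->
  (forall ls, chains (map ColLayer ls) (set0 : {set box lam mu}) =
              chains (map ColLayer ls) (set0 : {set box gam nu})) ->
  ncol (setT : {set box lam mu}) = ncol (setT : {set box gam nu}) ->
  overlaps lam mu 0 = overlaps gam nu 0 -> overlaps lam mu 1 <= overlaps gam nu 1.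
Proof.
move=> skew_lm skew_gn eqC eq_n eq_o.
have [w sw] := overlaps_attained skew_lm.
rewrite (chains_strips_eq eqC) //= lt0n eq_n eq_o.
exact: overlaps_bound.
Qed.

(** * Recovering the bottleneck numbers *)

Definition tent_sum lam mu s n k : nat :=
  \sum_(1 <= r < size lam) ((part mu r).+1 == part lam r.+1) * tent n k ((part mu r).+1 - s).

(** The tent function of k is concave and piecewise linear, with kinks exactly
    at p and n + 1 - p. *)
Lemma tent_second_difference n j p : 0 < j <= n -> 0 < p <= n ->
  (tent n j p).*2 = tent n j.-1 p + tent n j.+1 p + (p == j) + (p == n - j + 1).
Proof.
rewrite -addnA /tent => hj hp.
set x := minn p (n.+1 - p).
have -> : (p == j) + (p == n - j + 1) = (x == minn j (n.+1 - j)) * (1 + (j + j == n.+1)).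
  rewrite /x; have [h|h] := leqP p (n.+1 - p); have [h'|h'] := leqP j (n.+1 - j); lia.
(* Now 2 min(j, x) = min(j-1, x) + min(j+1, x) + (x == j), and similarly after reflection. *)
have {hp}: x + x <= n.+1 by rewrite /x; lia.
move: x => x hx.
have [h'|h'] := leqP j (n.+1 - j); lia.
Qed.

(** A bottleneck edge is a row overlap of size one, placed in its only column. *)
Lemma bottleneckE lam mu s n i : is_skew lam mu ->
  (forall i, 0 < i <= n -> column lam mu i = s + i) -> 0 < i <= n ->
  bottleneck lam mu i =
  \sum_(1 <= r < size lam) ((part mu r).+1 == part lam r.+1) * ((part mu r).+1 - s == i).
Proof.
move=> skew colE hi; rewrite /bottleneck colE // -sum1_count big_mkcond /=.
rewrite -(subn1 (size lam)); apply: eq_big_nat => r /andP[r0 _].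
rewrite bottleneck_edgeE //; last by lia.
by case: ifP; lia.
Qed.

Lemma bottleneck_second_difference lam mu s n j : is_skew lam mu ->
  (forall b : box lam mu, s < bcol b <= s + n) ->
  (forall i, 0 < i <= n -> column lam mu i = s + i) -> 0 < j <= n ->
  (tent_sum lam mu s n j).*2 = tent_sum lam mu s n j.-1 + tent_sum lam mu s n j.+1
     + (bottleneck lam mu j + bottleneck lam mu (n - j + 1)).
Proof.
move=> skew colR colE hj; rewrite !(bottleneckE skew colE) //; last by lia.
rewrite -addnn /tent_sum -!big_split /=; apply: eq_big_nat => r /andP[r0 _].
case: eqP => [e|_]; last by rewrite !mul0n.
rewrite !mul1n addnn tent_second_difference // ?addnA //.
have [|b [_ ec]] := @boxP _ _ skew r.+1 (part mu r).+1.
  by have := @mu_antimono _ _ skew r r.+1; rewrite /in_diagram -e; move: r0; clear; lia.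
by have := colR b; rewrite ec; clear; lia.
Qed.

Lemma two_value_coefficients lam mu s n k : is_skew lam mu -> cut_connected lam mu ->
  (forall b : box lam mu, s < bcol b <= s + n) ->
  (forall c, s < c <= s + n -> exists b : box lam mu, bcol b = c :> nat) ->
  0 < k <= n ->
  #|two_layer_ideals lam mu k (n.+1 - k)| = overlaps lam mu 1 + tent_sum lam mu s n k.
Proof.
move=> skew cut colR colE hk; rewrite (card_two_layer_ideals skew colR colE) //.
  by rewrite big_split; congr (_ + _); apply: eq_bigr => r _; rewrite addn1.
move=> c hc; apply: cut.
  by have [|b e] := colE c; [lia | exists b; rewrite e].
by have [|b e] := colE c.+1; [lia | exists b; rewrite e].
Qed.

Lemma overlaps0E lam mu s n : is_skew lam mu ->
  (forall b : box lam mu, s < bcol b <= s + n) ->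
  overlaps lam mu 0 = overlaps lam mu 1 + tent_sum lam mu s n 1.
Proof.
move=> skew colR; rewrite -big_split; apply: eq_big_nat => r /andP[r0 _] /=.
case: eqP => [e|]; last by lia.
have [|b [_ ec]] := @boxP _ _ skew r.+1 (part mu r).+1.
  by have := @mu_antimono _ _ skew r r.+1; rewrite /in_diagram -e; move: r0; clear; lia.
by have := colR b; rewrite ec /tent; lia.
Qed.

Theorem theorem3p10 (lam mu gam nu : seq nat) (n : nat)
    (skew_lm : is_skew lam mu) (skew_gn : is_skew gam nu)
    (conn_lm : is_connected lam mu)
    (ncols_lm : ncols lam mu = n)
    (eq_g : dual_grothendieck lam mu =1 dual_grothendieck gam nu) :
  ncols gam nu = n /\
  (forall i : nat, 1 <= i <= n ->
     bottleneck lam mu i + bottleneck lam mu (n - i + 1) =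
     bottleneck gam nu i + bottleneck gam nu (n - i + 1)).
Proof.
have eqC ls : chains (map ColLayer ls) (set0 : {set box lam mu}) =
              chains (map ColLayer ls) (set0 : {set box gam nu}).
  by rewrite -!dual_grothendieck_chains.
have eqB k l : #|two_layer_ideals lam mu k l| = #|two_layer_ideals gam nu k l|.
  by rewrite -!chains2; apply: (eqC [:: k; l]).
have nlm : ncol (setT : {set box lam mu}) = n by rewrite -ncols_ncol.
have ngn : ncol (setT : {set box gam nu}) = n.
  have := eqC [:: n]; rewrite -[map _ _]/[:: ColLayer n] !chains1 nlm eqxx.
  by case: eqP.
have ncols_gn : ncols gam nu = n by rewrite ncols_ncol.
split=> // i hi.
have cut_lm := is_connected_cut skew_lm conn_lm.
have cut_gn : cut_connected gam nu.
  apply: le1_cut_connected => //; rewrite ngn -eqB -nlm.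
  exact: cut_connected_le1.
have [s [rng ex col]] := columns_interval skew_lm cut_lm.
have [s' [rng' ex' col']] := columns_interval skew_gn cut_gn.
rewrite ncols_lm in rng ex col; rewrite ncols_gn in rng' ex' col'.
have coef k : 0 < k <= n -> overlaps lam mu 1 + tent_sum lam mu s n k =
                            overlaps gam nu 1 + tent_sum gam nu s' n k.
  by move=> hk; rewrite -!two_value_coefficients.
have eq_o0 : overlaps lam mu 0 = overlaps gam nu 0.
  by rewrite (overlaps0E skew_lm rng) (overlaps0E skew_gn rng') coef //; lia.
have eq_o1 : overlaps lam mu 1 = overlaps gam nu 1.
  by apply/eqP; rewrite eqn_leq !overlaps_le ?nlm ?ngn // => ls; rewrite eqC.
have eqT k : k <= n.+1 -> tent_sum lam mu s n k = tent_sum gam nu s' n k.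
  move=> hk; have [hk'|] := boolP (0 < k <= n).
    by apply/eqP; rewrite -(eqn_add2l (overlaps lam mu 1)) coef // eq_o1.
  move=> hk'; have z l m t : tent_sum l m t n k = 0.
    by rewrite /tent_sum big1 // => r _; rewrite /tent; lia.
  by rewrite !z.
have := bottleneck_second_difference skew_lm rng col hi.
have := bottleneck_second_difference skew_gn rng' col' hi.
by rewrite !eqT; lia.
Qed.
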